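(* Let $1<p\leq 2\leq q<\infty$ and let $H$ be a commutative hypergroup with Haar measure $\lambda$ and dual space $\widehat{H}$ equipped with the Plancherel measure $\pi$. There is a constant $C>0$, independent of $T$ and $h$, such that for every Fourier multiplier $T$ on $H$ with symbol $h\in L^\infty(\widehat{H},d\pi)$, $$\|T\|_{L^p(H,d\lambda)\rightarrow L^q(H,d\lambda)}\leq C\, \sup_{s>0}\, s \left[ \int_{\{\chi\in\widehat{H}:\,|h(\chi)|\geq s\}} d\pi(\chi) \right]^{\frac{1}{p}-\frac{1}{q}}.$$
   Context: A hypergroup is a nonempty locally compact Hausdorff space $H$ with a weakly continuous, associative convolution $*$ on the Banach space $M(H)$ of bounded regular Borel measures on $H$, making $(M(H),* )$ a Banach algebra, such that: (i) for all $x,y\in H$, $\delta_x*\delta_y$ is a probability measure with compact support ($\delta_x$ is the point mass at $x$), and $(x,y)\mapsto \mathrm{supp}(\delta_x*\delta_y)$ is continuous from $H\times H$ to the space of nonempty compact subsets of $H$ with the Michael (Vietoris) topology; (ii) there is a unique $e\in H$ with $\delta_x*\delta_e=\delta_e*\delta_x=\delta_x$ for all $x$; (iii) there is a homeomorphism $x\mapsto\check{x}$ of $H$ of order two which induces an involution on $M(H)$, where $\check{\mu}(E)=\mu(\check{E})$ for Borel sets $E$, and $e\in\mathrm{supp}(\delta_x*\delta_y)$ if and only if $x=\check{y}$. $H$ is commutative if $*$ is commutative. Write $f(x*y)=\int_H f\,d(\delta_x*\delta_y)$. A Haar measure is a nonzero positive Radon measure $\lambda$ on $H$ with $\int_H f(x*y)\,d\lambda(y)=\int_H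 f(y)\,d\lambda(y)$ for all $x\in H$, $f\in C_c(H)$; it exists for commutative $H$ and is unique up to a scalar multiple. The dual space is $\widehat{H}=\{\chi : H\to\mathbb{C}\text{ bounded continuous}:\chi\neq0,\ \chi(\check{x})=\overline{\chi(x)},\ \chi(x*y)=\chi(x)\chi(y)\ \forall x,y\in H\}$, with the compact-open topology. The Fourier transform of $f\in L^1(H,\lambda)$ is $\widehat{f}(\chi)=\int_H f(x)\overline{\chi(x)}\,d\lambda(x)$. The Plancherel measure $\pi$ is the unique positive Borel measure on $\widehat{H}$ with $\int_H|f|^2d\lambda=\int_{\widehat{H}}|\widehat{f}|^2d\pi$ for all $f\in L^1(H,\lambda)\cap L^2(H,\lambda)$; the Fourier transform extends to a unitary operator from $L^2(H,\lambda)$ onto $L^2(\widehat{H},\pi)$. For $h\in L^\infty(\widehat{H},d\pi)$, the Fourier multiplier with symbol $h$ is the operator $T=T_h$ given by $\widehat{T_hf}(\chi)=h(\chi)\widehat{f}(\chi)$, $\chi\in\widehat{H}$; it is bounded on $L^2(H,d\lambda)$. The norm $\|T\|_{L^p\to L^q}$ is the least constant $N\in[0,\infty]$ with $\|Tf\|_{L^q(H,d\lambda)}\le N\|f\|_{L^p(H,d\lambda)}$ for all $f\in C_c(H)$; if it is finite, $T$ extends to a bounded operator $L^p(H,d\lambda)\to L^q(H,d\lambda)$. *)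

(* Defs.v *)
From HB Require Import structures.
From mathcomp Require Import all_boot all_order all_algebra.
From mathcomp Require Import all_classical all_reals all_analysis.
From mathcomp Require Import complex.

Set Implicit Arguments.
Unset Strict Implicit.
Unset Printing Implicit Defensive.

Import Order.TTheory GRing.Theory Num.Theory.
Import numFieldNormedType.Exports.
Import Normc.

Local Open Scope classical_set_scope.
Local Open Scope ring_scope.
Local Open Scope complex_scope.

(* [R[i]^o] is [R[i]] with the topology given by its modulus. *)
Notation cplx R := (R[i]^o).
Notation borel T := (g_sigma_algebraType (@open T)).

Section complex_functions.
Context {R : realType}.

Definition cmod {T : Type} (f : T -> cplx R) : T -> \bar R :=
  fun x => (normc (f x))%:E.

Definition cmeasurable {d} {T : measurableType d} (f : T -> cplx R) : Prop :=
  measurable_fun [set: T] (fun x => complex.Re (f x)) /\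
  measurable_fun [set: T] (fun x => complex.Im (f x)).

(* As for the library's [integral], [mu] may be a bare set function. *)
Definition cintegral {d} {T : measurableType d} (mu : set T -> \bar R)
    (f : T -> cplx R) : cplx R :=
  fine (\int[mu]_x (complex.Re (f x))%:E)%E +i*
  fine (\int[mu]_x (complex.Im (f x))%:E)%E.

Definition cLnorm {d} {T : measurableType d} (mu : {measure set T -> \bar R})
    (p : \bar R) (f : T -> cplx R) : \bar R := Lnorm mu p (cmod f).

Definition in_Lp {d} {T : measurableType d} (mu : {measure set T -> \bar R})
    (p : \bar R) (f : T -> cplx R) : Prop :=
  cmeasurable f /\ (cLnorm mu p f < +oo)%E.

Lemma cvg_Re (u : nat -> cplx R) (l : cplx R) : u @ \oo --> l ->
  (fun k => complex.Re (u k)) @ \oo --> complex.Re l.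
Proof.
move=> ul; apply/cvgrPdist_lt => e e0.
have e0C : 0 < e%:C :> R[i] by rewrite ltcR.
have /cvgrPdist_lt/(_ _ e0C) := ul.
apply: filterS => k; rewrite -raddfB/= -ltcR; apply: le_lt_trans.
case: (l - u k) => a b /=; rewrite normc_def lecR -sqrtr_sqr.
by rewrite ler_wsqrtr// lerDl sqr_ge0.
Qed.

Definition Cb (H : topologicalType) : set (H -> cplx R) :=
  [set f : H -> cplx R | continuous f /\ exists M : R, forall x, normc (f x) <= M].

Definition Cc (H : topologicalType) : set (H -> cplx R) :=
  [set f : H -> cplx R | continuous f /\ compact (closure [set x | f x != 0])].

End complex_functions.

Section measure_space.
Context {R : realType} {H : ptopologicalType}.
Implicit Types (m n : set H -> cplx R).

Definition Borel : set (set H) := @measurable _ (borel H).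

Definition total_variation m (A : set H) : \bar R :=
  ereal_sup [set s | exists (k : nat) (F : 'I_k -> set H),
    [/\ forall i, Borel (F i), trivIset [set: 'I_k] F,
        forall i, F i `<=` A & s = (\sum_(i < k) (normc (m (F i)))%:E)%E]].

(* M(H). The value 0 is imposed off the Borel sets, so that equality of
   measures is equality of functions on all of [set H]. *)
Definition bounded_measure : set (set H -> cplx R) :=
  [set m | [/\ forall A, ~ Borel A -> m A = 0,
    forall F : nat -> set H, (forall k, Borel (F k)) ->
      trivIset [set: nat] F ->
      (fun k => \sum_(i < k) m (F i)) @ \oo --> m (\bigcup_k F k) &
    forall (A : set H) (eps : R), Borel A -> 0 < eps ->
      exists F U : set H, [/\ compact F, open U, F `<=` A, A `<=` U &
        (total_variation m (U `\` F) < eps%:E)%E]]].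

(* In [R[i]], [0 <= z] means that z is real and nonnegative. *)
Definition pos_measure : set (set H -> cplx R) :=
  [set m | bounded_measure m /\ forall A, 0 <= m A].

Definition prob_measure : set (set H -> cplx R) :=
  [set m | pos_measure m /\ m [set: H] = 1].

Definition real_measure m : set (borel H) -> \bar R :=
  fun A => (complex.Re (m A))%:E.

(* Meaningful for [m] in [pos_measure] only. *)
Definition mintegral m (f : H -> cplx R) : cplx R :=
  cintegral (real_measure m) f.

Lemma mintegral1 m : prob_measure m ->
  mintegral m (fun=> 1 : cplx R) = 1.
Proof.
move=> [[[mB msum _] mge0] m1].
have m0 : m set0 = 0.
  have := msum (fun=> set0) (fun=> @measurable0 _ (borel H))
    (@trivIset_set0 _ _ _).
  under eq_fun do rewrite sumr_const card_ord.
  rewrite bigcup0// => u0.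
  have := cvgB (cvg_comp _ _ (cvg_addnr 1) u0) u0.
  rewrite subrr (_ : _ - _ = fun=> m set0); last first.
    by apply/funext => k; rewrite !fctE /= addn1 mulrS addrK.
  by move=> c0; apply: (cvg_unique _ (cvg_cst (m set0)) (c0 _)).
have mu0 : real_measure m set0 = 0%E by rewrite /real_measure m0.
have muge0 A : (0 <= real_measure m A)%E.
  by rewrite lee_fin; have := mge0 A; rewrite lecE => /andP[].
have musum : semi_sigma_additive (real_measure m).
  move=> F mF tF mUF.
  under eq_fun do rewrite sumEFin big_mkord -raddf_sum.
  exact: cvg_comp (cvg_Re (msum F mF tF)) _.
pose mu : {measure set (borel H) -> \bar R} :=
  HB.pack (real_measure m)
    (isMeasure.Build _ _ _ (real_measure m) mu0 muge0 musum).
have i1 : (\int[real_measure m]_(x in [set: borel H]) 1%:E = 1)%E.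
  rewrite (@integral_cst _ (borel H) R mu [set: H] measurableT 1).
  by rewrite mul1e /= /real_measure m1.
have i0 : (\int[real_measure m]_(x in [set: borel H]) 0%:E = 0)%E.
  exact: (@integral0 _ (borel H) R mu [set: H]).
by rewrite /mintegral /cintegral /= i1 i0.
Qed.

Definition mdirac (x : H) : set H -> cplx R :=
  fun A => if `[< Borel A /\ A x >] then 1 else 0.

(* Meaningful for [m] in [pos_measure] only. *)
Definition msupp m : set H :=
  [set x | forall U : set H, open U -> U x -> m U != 0].

(* The topology sigma(M(H), C_b(H)), used on [pos_measure] only. *)
Definition Cb_pairing m : {ptws (set_type (@Cb R H)) -> cplx R} :=
  fun f => mintegral m (set_val f).

Definition weak_measures : Type := initial_topology Cb_pairing.
HB.instance Definition _ := Topological.on weak_measures.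

End measure_space.

Arguments weak_measures : clear implicits.

Section michael.
Context {H : ptopologicalType}.

(* The nonempty compact subsets form a subspace; continuity into it is
   continuity into [michael H]. *)
Definition michael : Type := set H.
HB.instance Definition _ := Choice.on michael.
HB.instance Definition _ := @isSubBaseTopological.Build michael
  (set H * set H)%type [set UV | open UV.1 /\ open UV.2]
  (fun UV => [set A : set H | A `&` UV.1 !=set0 /\ A `<=` UV.2]).

End michael.

Arguments michael : clear implicits.

Record hypergroup (R : realType) (H : ptopologicalType) := Hypergroup {
  hconv : (set H -> cplx R) -> (set H -> cplx R) -> (set H -> cplx R) ;
  hunit : H ;
  hinv : H -> H ;
  hypergroup_hausdorff : hausdorff_space H ;
  hypergroup_lcompact : locally_compact [set: H] ;
  (* (M(H), * ) is a Banach algebra *)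
  hconvM : forall m n, bounded_measure m -> bounded_measure n ->
    bounded_measure (hconv m n) ;
  hconvDl : forall m1 m2 n, bounded_measure m1 -> bounded_measure m2 ->
    bounded_measure n -> hconv (m1 \+ m2) n = hconv m1 n \+ hconv m2 n ;
  hconvDr : forall m n1 n2, bounded_measure m -> bounded_measure n1 ->
    bounded_measure n2 -> hconv m (n1 \+ n2) = hconv m n1 \+ hconv m n2 ;
  hconvZl : forall (a : cplx R) m n, bounded_measure m -> bounded_measure n ->
    hconv (a \*o m) n = a \*o hconv m n ;
  hconvZr : forall (a : cplx R) m n, bounded_measure m -> bounded_measure n ->
    hconv m (a \*o n) = a \*o hconv m n ;
  hconvA : forall m1 m2 m3, bounded_measure m1 -> bounded_measure m2 ->
    bounded_measure m3 -> hconv m1 (hconv m2 m3) = hconv (hconv m1 m2) m3 ;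
  hconv_norm : forall m n, bounded_measure m -> bounded_measure n ->
    (total_variation (hconv m n) [set: H] <=
     total_variation m [set: H] * total_variation n [set: H])%E ;
  (* Weak continuity, in the sense of Jewett: * maps the product of the cones
     of positive measures into the positive cone, continuously for the weak
     topology. (Joint weak continuity on M(H) x M(H) fails for every infinite
     locally compact group.) *)
  hconv_pos : forall m n, pos_measure m -> pos_measure n ->
    pos_measure (hconv m n) ;
  hconv_weak_continuous : {within (pos_measure `*` pos_measure :
              set (weak_measures R H * weak_measures R H)),
    continuous (fun z : weak_measures R H * weak_measures R H =>
                  hconv z.1 z.2 : weak_measures R H)} ;
  hconv_dirac_prob : forall x y, prob_measure (hconv (mdirac x) (mdirac y)) ;
  hconv_dirac_compact : forall x y,
    compact (msupp (hconv (mdirac x) (mdirac y))) ;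
  hconv_dirac_continuous : continuous (fun z : H * H =>
    msupp (hconv (mdirac z.1) (mdirac z.2)) : michael H) ;
  hunitP : forall x, hconv (mdirac x) (mdirac hunit) = mdirac x /\
                     hconv (mdirac hunit) (mdirac x) = mdirac x ;
  hunit_unique : forall e, (forall x,
    hconv (mdirac x) (mdirac e) = mdirac x /\
    hconv (mdirac e) (mdirac x) = mdirac x) -> e = hunit ;
  (* The identity is allowed, as for hermitian hypergroups. *)
  hinvK : involutive hinv ;
  hinv_continuous : continuous hinv ;
  hconv_inv : forall m n, bounded_measure m -> bounded_measure n ->
    (fun E => hconv m n (hinv @` E)) =
    hconv (fun E => n (hinv @` E)) (fun E => m (hinv @` E)) ;
  hinv_supp : forall x y,
    msupp (hconv (mdirac x) (mdirac y)) hunit <-> x = hinv y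
}.

Section dual_space.
Context {R : realType} {H : ptopologicalType} (K : hypergroup R H).

Definition commutative_hypergroup : Prop :=
  forall m n, bounded_measure m -> bounded_measure n ->
    hconv K m n = hconv K n m.

(* f(x * y) *)
Definition htranslate (f : H -> cplx R) (x y : H) : cplx R :=
  mintegral (hconv K (mdirac x) (mdirac y)) f.

Definition characters : set {compact-open, H -> cplx R} :=
  [set chi : H -> cplx R | [/\ Cb chi, exists x, chi x != 0,
     forall x, chi (hinv K x) = (chi x)^* &
     forall x y, htranslate chi x y = chi x * chi y]].

Definition dual : Type := set_type characters.

Definition char_fun (chi : dual) : H -> cplx R := set_val chi.

Lemma characters1 : characters (fun=> 1 : cplx R).
Proof.
split.
- split; first by move=> x; exact: cvg_cst.
  by exists 1 => x; rewrite normc1.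
- by exists (hunit K); rewrite oner_neq0.
- by move=> x; rewrite /conjc /= oppr0.
- by move=> x y; rewrite /htranslate mintegral1 ?mulr1//; exact: hconv_dirac_prob.
Qed.

HB.instance Definition _ := Topological.on dual.
HB.instance Definition _ := isPointed.Build dual
  (exist _ (fun=> 1 : cplx R) (mem_set characters1)).

End dual_space.

Section fourier.
Context {R : realType} {H : ptopologicalType} (K : hypergroup R H).
Variable lam : {measure set (borel H) -> \bar R}.

Definition radon : Prop :=
  [/\ forall F : set H, compact F -> (lam F < +oo)%E,
      forall A : set H, Borel A ->
        lam A = ereal_inf [set lam U | U in [set U | open U /\ A `<=` U]] &
      forall U : set H, open U ->
        lam U = ereal_sup [set lam F | F in [set F | compact F /\ F `<=` U]]].

Definition haar_measure : Prop :=
  [/\ radon, lam [set: H] != 0%E &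
      forall (x : H) (f : H -> cplx R), Cc f ->
        cintegral lam (fun y => htranslate K f x y) = cintegral lam f].

Definition fourier (f : H -> cplx R) (chi : dual K) : cplx R :=
  cintegral lam (fun x => f x * (char_fun chi x)^*).

Variable pi : {measure set (borel (dual K)) -> \bar R}.

Definition plancherel_measure : Prop :=
  forall f : H -> cplx R, in_Lp lam 1 f -> in_Lp lam 2%:E f ->
    (\int[lam]_x (normc (f x) ^+ 2)%:E =
     \int[pi]_chi (normc (fourier f chi) ^+ 2)%:E)%E.

(* [g] represents the L^2-extension of the Fourier transform at [f]. *)
Definition plancherel_transform (f : H -> cplx R) (g : dual K -> cplx R) : Prop :=
  [/\ in_Lp lam 2%:E f, in_Lp pi 2%:E g &
    exists f_ : nat -> H -> cplx R,
      [/\ forall k, in_Lp lam 1 (f_ k) /\ in_Lp lam 2%:E (f_ k),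
          cLnorm lam 2%:E (f_ k \- f) @[k --> \oo] --> 0%E &
          cLnorm pi 2%:E (fourier (f_ k) \- g) @[k --> \oo] --> 0%E]].

(* [T] acts on representatives, its values being determined up to a null set. *)
Definition fourier_multiplier (h : dual K -> cplx R)
    (T : (H -> cplx R) -> (H -> cplx R)) : Prop :=
  forall f, in_Lp lam 2%:E f -> in_Lp lam 2%:E (T f) /\
    forall g, plancherel_transform f g -> plancherel_transform (T f) (h \* g).

Definition opnorm (p q : R) (T : (H -> cplx R) -> (H -> cplx R)) : \bar R :=
  ereal_inf [set N : \bar R | (0 <= N)%E /\ forall f, Cc f ->
    (cLnorm lam q%:E (T f) <= N * cLnorm lam p%:E f)%E].

(* sup_{s > 0} s [pi {|h| >= s}]^r. For r = 0 the convention is 0^0 = 0, so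
   that the value is then the essential supremum of |h|; with 0^0 = 1 it would
   always be +oo. *)
Definition weak_norm (r : R) (h : dual K -> cplx R) : \bar R :=
  let level (s : R) := pi [set chi | s <= normc (h chi)] in
  ereal_sup [set (if level s == 0 then 0 else s%:E * level s `^ r)%E
            | s in [set s : R | 0 < s]].

End fourier.

(* Main.v *)
Require Import Defs.
From HB Require Import structures.
From mathcomp Require Import all_boot all_order all_algebra.
From mathcomp Require Import all_classical all_reals all_analysis.
From mathcomp Require Import measurable_realfun complex.
From mathcomp Require Import ring lra.

(** This is Hoermander's multiplier theorem. It follows from three properties
of the Fourier transform: it is additive, it maps $L^1$ to bounded functions
without increasing the norm, and it is isometric on $L^1 \cap L^2$
(Plancherel). The second one rests on $|\chi| \le 1$ for characters, which
follows from $\chi(x)^2 = \chi(x * x)$. These properties, together with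
measurability of the transforms, are collected in [fourier_like];
measurability holds because the transform of an integrable function is
continuous on the dual ([fourier_continuous]), the Haar measure being tight
on such a function.

Duality reduces the bound of $T f$ in $L^q$ to a bound of the form
$\int |h| |\hat f| |\hat k| d\pi \le C M \|f\|_p \|k\|_{q'}$, where $M$ is the
weak norm of the symbol [h] ([multiplier_form_le]). Indeed
$4 Re \int T f \bar k = \|T f + k\|^2 - \|T f - k\|^2$, and by Plancherel the
right hand side equals the same expression in $h \hat f$ and $\hat k$
([truncated_Lq_bound]).

Both $p$ and $q'$ lie in $]1, 2]$. With $1/r = 1/p - 1/q$, the function
$\phi = (|h|/M)^r$ has weak $L^1$ norm at most one, and $|h|$ is $M$ times
the product of $\phi^{1/p - 1/2}$ and $\phi^{1/q' - 1/2}$. The form is thus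
controlled by two instances, for $a = p$ and $a = q'$, of Paley's inequality
$\int \phi^{2/a - 1} |\hat f|^2 d\pi \le C \|f\|_a^2$ ([paley_inequality]).
In the limiting case $p = q = 2$ the symbol is essentially bounded by $M$, and
Plancherel's identity suffices.

Paley's inequality is proved by real interpolation, carried out by hand. Cut
$\phi$ along dyadic levels, and on the level where $\phi$ is about $t^{-a}$
(for $\|f\|_a = 1$) cut $f$ at height $t$. The small part of $f$ goes through
Plancherel, the large one through the $L^1$-$L^\infty$ bound and the measure
of the level set. After summation over the levels each value $|f(x)|$ meets
two geometric sums, both of the size of $|f(x)|^a$ ([dyadic_split_sum_le]). *)

Set Implicit Arguments.
Unset Strict Implicit.
Unset Printing Implicit Defensive.

Import Order.TTheory GRing.Theory Num.Theory.
Import numFieldNormedType.Exports.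
Import Normc.

Local Open Scope classical_set_scope.
Local Open Scope ring_scope.
Local Open Scope complex_scope.

(** * Complex-valued functions and their integrals *)

Section complex_modulus.
Context {R : realType}.
Implicit Types z w : cplx R.

Lemma sqr_normcE z : normc z ^+ 2 = complex.Re z ^+ 2 + complex.Im z ^+ 2.
Proof. by case: z => a b /=; rewrite sqr_sqrtr// addr_ge0// sqr_ge0. Qed.

Lemma normc_ge0 z : 0 <= normc z.
Proof. by case: z => a b /=; exact: sqrtr_ge0. Qed.

Lemma normcD_le z w : normc (z + w) <= normc z + normc w.
Proof. exact: (@le_normcD _ (z : Rcomplex R) w). Qed.

Lemma normc_conj z : normc (z^*) = normc z.
Proof. by case: z => a b /=; rewrite sqrrN. Qed.

Lemma ler_Re_normc z : `|complex.Re z| <= normc z.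
Proof.
case: z => a b /=; rewrite -sqrtr_sqr ler_wsqrtr// lerDl; exact: sqr_ge0.
Qed.

Lemma ler_Im_normc z : `|complex.Im z| <= normc z.
Proof.
case: z => a b /=; rewrite -sqrtr_sqr ler_wsqrtr// lerDr; exact: sqr_ge0.
Qed.

Lemma normc_real (x : R) : normc (x%:C) = `|x|.
Proof. by rewrite /= expr0n addr0 sqrtr_sqr. Qed.

Lemma sqr_normcD z w :
  normc (z + w) ^+ 2 <= 2 * normc z ^+ 2 + 2 * normc w ^+ 2.
Proof.
apply: (@le_trans _ _ ((normc z + normc w) ^+ 2)).
  by rewrite lerXn2r ?nnegrE ?addr_ge0 ?normc_ge0//; exact: normcD_le.
rewrite -subr_ge0 [leRHS](_ : _ = (normc z - normc w) ^+ 2) ?sqr_ge0//; ring.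
Qed.

Lemma polarization z w : normc (z + w) ^+ 2 =
  normc (z - w) ^+ 2 + 4 * complex.Re (z * w^*).
Proof.
by rewrite !sqr_normcE; case: z w => a b [c d] /=; ring.
Qed.

End complex_modulus.

Section real_integrals.
Context {R : realType} d (T : measurableType d) (mu : {measure set T -> \bar R}).
Implicit Types f g : T -> R.

Lemma ge0_le_integral_EFin f g :
  measurable_fun [set: T] f -> measurable_fun [set: T] g ->
  (forall x, 0 <= f x) -> (forall x, f x <= g x) ->
  (\int[mu]_x (f x)%:E <= \int[mu]_x (g x)%:E)%E.
Proof.
move=> mf mg f0 fg; apply: ge0_le_integral => //.
- by move=> x _; rewrite lee_fin.
- exact/measurable_EFinP.
- exact/measurable_EFinP.
- by move=> x _; rewrite lee_fin.
Qed.

Lemma ge0_integralD_EFin f g :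
  measurable_fun [set: T] f -> measurable_fun [set: T] g ->
  (forall x, 0 <= f x) -> (forall x, 0 <= g x) ->
  (\int[mu]_x (f x + g x)%:E = \int[mu]_x (f x)%:E + \int[mu]_x (g x)%:E)%E.
Proof.
move=> mf mg f0 g0; rewrite -ge0_integralD//.
- by move=> x _; rewrite lee_fin.
- exact/measurable_EFinP.
- by move=> x _; rewrite lee_fin.
- exact/measurable_EFinP.
Qed.

Lemma ge0_integralZl_real f (c : R) :
  measurable_fun [set: T] f -> (forall x, 0 <= f x) -> 0 <= c ->
  (\int[mu]_x (c * f x)%:E = c%:E * \int[mu]_x (f x)%:E)%E.
Proof.
move=> mf f0 c0; under eq_integral do rewrite EFinM.
rewrite ge0_integralZl_EFin//.
  by move=> x _; rewrite lee_fin.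
exact/measurable_EFinP.
Qed.

Lemma ge0_integral_sum_EFin (n : nat) (f : nat -> T -> R) :
  (forall i, measurable_fun [set: T] (f i)) -> (forall i x, 0 <= f i x) ->
  (\int[mu]_x (\sum_(i < n) f i x)%:E = \sum_(i < n) \int[mu]_x (f i x)%:E)%E.
Proof.
move=> mf f0; under eq_integral do rewrite -sumEFin.
rewrite (@ge0_integral_sum _ _ _ mu _ measurableT 'I_n (fun i x => (f i x)%:E))//.
- by move=> i; exact/measurable_EFinP.
- by move=> i x _; rewrite lee_fin.
Qed.

Lemma integral_ge0_EFin f : (forall x, 0 <= f x) ->
  (0 <= \int[mu]_x (f x)%:E)%E.
Proof. by move=> f0; apply: integral_ge0 => x _; rewrite lee_fin. Qed.

End real_integrals.

Section complex_integrals.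
Context {R : realType} d (T : measurableType d) (mu : {measure set T -> \bar R}).
Implicit Types f g : T -> cplx R.

Lemma cmeasurable_normc f :
  cmeasurable f -> measurable_fun [set: T] (fun x => normc (f x)).
Proof.
move=> [mr mi].
rewrite (_ : (fun x => normc (f x)) =
  fun x => Num.sqrt (complex.Re (f x) ^+ 2 + complex.Im (f x) ^+ 2)).
  apply: (@measurableT_comp _ _ _ _ _ _ (@Num.sqrt R)).
    by apply: continuous_measurable_fun => x; exact: sqrt_continuous.
  by apply: measurable_funD; exact: measurable_funX.
by apply/funext => x; case: (f x).
Qed.

Lemma cmeasurableD f g :
  cmeasurable f -> cmeasurable g -> cmeasurable (fun x => f x + g x).
Proof.
move=> [fr fi] [gr gi]; split.
  rewrite (_ : (fun x => _) = fun x => complex.Re (f x) + complex.Re (g x)).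
    exact: measurable_funD.
  by apply/funext => x; case: (f x) (g x) => ? ? [].
rewrite (_ : (fun x => _) = fun x => complex.Im (f x) + complex.Im (g x)).
  exact: measurable_funD.
by apply/funext => x; case: (f x) (g x) => ? ? [].
Qed.

Lemma cmeasurableM f g :
  cmeasurable f -> cmeasurable g -> cmeasurable (fun x => f x * g x).
Proof.
move=> [fr fi] [gr gi]; split.
  rewrite (_ : (fun x => _) = fun x => complex.Re (f x) * complex.Re (g x)
    - complex.Im (f x) * complex.Im (g x)).
    by apply: measurable_funB; exact: measurable_funM.
  by apply/funext => x; case: (f x) (g x) => ? ? [].
rewrite (_ : (fun x => _) = fun x => complex.Re (f x) * complex.Im (g x)
    + complex.Im (f x) * complex.Re (g x)).
  by apply: measurable_funD; exact: measurable_funM.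
by apply/funext => x; case: (f x) (g x) => ? ? [].
Qed.

Lemma cmeasurable_conj f : cmeasurable f -> cmeasurable (fun x => (f x)^*).
Proof.
move=> [fr fi]; split.
  by rewrite (_ : (fun x => _) = fun x => complex.Re (f x))//;
    apply/funext => x; case: (f x).
rewrite (_ : (fun x => _) = fun x => - complex.Im (f x)).
  exact: measurableT_comp.
by apply/funext => x; case: (f x).
Qed.

Lemma cmeasurable_real (r : T -> R) :
  measurable_fun [set: T] r -> cmeasurable (fun x => (r x)%:C : cplx R).
Proof. by move=> mr; split => //=; exact: measurable_cst. Qed.

Lemma cmeasurableN f : cmeasurable f -> cmeasurable (fun x => - f x).
Proof.
move=> mf; rewrite (_ : (fun x => _) = fun x => ((-1 : R)%:C : cplx R) * f x).
  by apply: cmeasurableM => //; apply: cmeasurable_real; exact: measurable_cst.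
by apply/funext => x; rewrite rmorphN1 mulN1r.
Qed.

Lemma cmeasurableB f g :
  cmeasurable f -> cmeasurable g -> cmeasurable (fun x => f x - g x).
Proof. by move=> mf mg; apply: cmeasurableD => //; exact: cmeasurableN. Qed.

Lemma cLnorm2E f :
  cLnorm mu 2%:E f = ((\int[mu]_x (normc (f x) ^+ 2)%:E) `^ 2^-1)%E.
Proof.
rewrite /cLnorm unlock; congr (_ `^ _)%E; apply: eq_integral => x _ /=.
by rewrite (ger0_norm (normc_ge0 _)) powR_mulrn ?normc_ge0.
Qed.

Lemma cLnormE (p : R) f :
  cLnorm mu p%:E f = ((\int[mu]_x (normc (f x) `^ p)%:E) `^ p^-1)%E.
Proof.
rewrite /cLnorm unlock; congr (_ `^ _)%E; apply: eq_integral => x _ /=.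
by rewrite (ger0_norm (normc_ge0 _)).
Qed.

Lemma in_Lp1P f : in_Lp mu 1%:E f <->
  cmeasurable f /\ (\int[mu]_x (normc (f x))%:E < +oo)%E.
Proof.
rewrite /in_Lp /cLnorm Lnorm1.
by under eq_integral do rewrite abse_EFin (ger0_norm (normc_ge0 _)).
Qed.

Lemma in_Lp2P f : in_Lp mu 2%:E f <->
  cmeasurable f /\ (\int[mu]_x (normc (f x) ^+ 2)%:E < +oo)%E.
Proof.
rewrite /in_Lp cLnorm2E; split=> -[mf H]; split => //.
  by apply: lty_poweRy H; rewrite invr_neq0.
exact: poweR_lty.
Qed.

Lemma in_Lp1_integrable_Re f : in_Lp mu 1%:E f ->
  mu.-integrable [set: T] (EFin \o (fun x => complex.Re (f x))).
Proof.
move=> /in_Lp1P[[mr mi] fi]; apply/integrableP; split.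
  exact/measurable_EFinP.
apply: le_lt_trans fi; apply: ge0_le_integral_EFin => //.
- exact: measurableT_comp.
- exact: cmeasurable_normc.
- by move=> x; exact: ler_Re_normc.
Qed.

Lemma in_Lp1_integrable_Im f : in_Lp mu 1%:E f ->
  mu.-integrable [set: T] (EFin \o (fun x => complex.Im (f x))).
Proof.
move=> /in_Lp1P[[mr mi] fi]; apply/integrableP; split.
  exact/measurable_EFinP.
apply: le_lt_trans fi; apply: ge0_le_integral_EFin => //.
- exact: measurableT_comp.
- exact: cmeasurable_normc.
- by move=> x; exact: ler_Im_normc.
Qed.

Lemma cintegralD f g : in_Lp mu 1%:E f -> in_Lp mu 1%:E g ->
  cintegral mu (fun x => f x + g x) = cintegral mu f + cintegral mu g.
Proof.
move=> f1 g1; rewrite /cintegral; apply/eqP; rewrite eq_complex /=.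
have -> : (fun x => (complex.Re (f x + g x))%:E) =
    (fun x => (complex.Re (f x))%:E + (complex.Re (g x))%:E)%E.
  by apply/funext => x; case: (f x) (g x) => ? ? [].
have -> : (fun x => (complex.Im (f x + g x))%:E) =
    (fun x => (complex.Im (f x))%:E + (complex.Im (g x))%:E)%E.
  by apply/funext => x; case: (f x) (g x) => ? ? [].
have fr := in_Lp1_integrable_Re f1; have fi := in_Lp1_integrable_Im f1.
have gr := in_Lp1_integrable_Re g1; have gi := in_Lp1_integrable_Im g1.
rewrite !integralD// (fineD (integrable_fin_num _ fr) (integrable_fin_num _ gr))//.
by rewrite (fineD (integrable_fin_num _ fi) (integrable_fin_num _ gi))// !eqxx.
Qed.

(** Rotating the integral onto the positive real axis: with [u] the unit
vector in the direction of the integral, its modulus is the integral of the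
real scalar product of [f] with [u]. *)
Lemma normc_cintegral_le f : in_Lp mu 1%:E f ->
  ((normc (cintegral mu f))%:E <= \int[mu]_x (normc (f x))%:E)%E.
Proof.
move=> f1; have fr := in_Lp1_integrable_Re f1.
have fi := in_Lp1_integrable_Im f1.
have [mf _] := (in_Lp1P f).1 f1.
set I := cintegral mu f; have [->|I0] := eqVneq (normc I) 0.
  by apply: integral_ge0_EFin => x; exact: normc_ge0.
have Ip : 0 < normc I by rewrite lt_def I0 normc_ge0.
pose a := complex.Re I / normc I; pose b := complex.Im I / normc I.
have ab : a ^+ 2 + b ^+ 2 = 1.
  by rewrite !expr_div_n -mulrDl -sqr_normcE divff// expf_neq0.
have -> : (normc I)%:E =
  (\int[mu]_x (a * complex.Re (f x) + b * complex.Im (f x))%:E)%E.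
  have -> : normc I = a * complex.Re I + b * complex.Im I.
    by rewrite /a /b -!mulrA ![(normc I)^-1 * _]mulrC !mulrA -mulrDl -!expr2
      -sqr_normcE expr2 -mulrA divff// mulr1.
  under eq_integral do rewrite EFinD !EFinM.
  rewrite integralD//; [|exact: integrableZl|exact: integrableZl].
  rewrite !integralZl// /I /cintegral /= EFinD !EFinM !fineK//;
    exact: integrable_fin_num.
apply: le_integral => //.
- under eq_fun do rewrite EFinD !EFinM.
  by apply: integrableD => //; exact: integrableZl.
- apply/integrableP; split.
    by apply/measurable_EFinP; exact: cmeasurable_normc.
  under eq_integral do rewrite abse_EFin (ger0_norm (normc_ge0 _)).
  by have [] := (in_Lp1P f).1 f1.
- move=> x _; rewrite lee_fin; case: (f x) => y z /=.
  apply: (le_trans (ler_norm _)); rewrite -sqrtr_sqr ler_wsqrtr//.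
  rewrite -[leRHS]mul1r -ab -subr_ge0.
  by rewrite [leRHS](_ : _ = (a * z - b * y) ^+ 2) ?sqr_ge0//; ring.
Qed.

Lemma cLnorm2_triangle f g : cmeasurable f -> cmeasurable g ->
  (cLnorm mu 2%:E (fun x => f x + g x)%R <=
   cLnorm mu 2%:E f + cLnorm mu 2%:E g)%E.
Proof.
move=> mf mg; have nf := cmeasurable_normc mf; have ng := cmeasurable_normc mg.
have := @minkowski_EFin _ _ _ mu _ _ 2 nf ng.
move=> /(_ (ler1n _ 2)); apply: le_trans.
rewrite cLnorm2E unlock; apply: gt0_ler_poweR; rewrite ?invr_ge0//.
- by rewrite in_itv /= leey integral_ge0_EFin// => x; exact: sqr_ge0.
- rewrite in_itv /= leey andbT; apply: integral_ge0 => x _; exact: powR_ge0.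
apply: ge0_le_integral => //=.
- by move=> x _; rewrite lee_fin sqr_ge0.
- apply/measurable_EFinP/measurable_funX/cmeasurable_normc.
  exact: cmeasurableD.
- under eq_fun do rewrite powR_mulrn//.
  apply/measurable_EFinP/measurable_funX/measurableT_comp => //.
  exact: measurable_funD.
move=> x _; rewrite powR_mulrn// lee_fin.
rewrite lerXn2r ?nnegrE ?normc_ge0//.
by apply: le_trans (normcD_le _ _) _; exact: ler_norm.
Qed.

End complex_integrals.

(** * Dyadic sums *)

Section dyadic_sums.
Context {R : realType}.
Implicit Types (b : nat -> bool) (d q X : R).

Lemma powR2_lt1 (e : R) : e < 0 -> 2 `^ e < 1.
Proof.
move=> e0; rewrite /powR pnatr_eq0/=.
by rewrite expR_lt1 nmulr_rlt0 ?ln_gt0 ?ltr1n.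
Qed.

Lemma sum_geometric_le q d n : 0 < q < 1 -> 0 <= d ->
  \sum_(j < n) d * q ^+ j <= d / (1 - q).
Proof.
move=> /andP[q0 q1] d0; elim: n d d0 => [|n IH] d d0.
  by rewrite big_ord0 divr_ge0// subr_ge0 ltW.
rewrite big_ord_recl expr0 mulr1.
under eq_bigr do rewrite lift0 exprS mulrA.
apply: (@le_trans _ _ (d + d * q / (1 - q))).
  by rewrite lerD2l IH// mulr_ge0// ltW.
have : 1 - q != 0 by rewrite subr_eq0 gt_eqF.
by move=> q1'; rewrite le_eqVlt; apply/orP; left; apply/eqP; field.
Qed.

(** The selected terms are bounded by a geometric series starting at the first
selected one, which is at most [X]. *)
Lemma sum_geometric_decr_le b q d X n : 0 < q < 1 -> 0 <= d -> 0 <= X ->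
  (forall j, b j -> d * q ^+ j <= X) ->
  \sum_(j < n) (b j)%:R * (d * q ^+ j) <= X / (1 - q).
Proof.
move=> q01 + X0; have /andP[q0 q1] := q01.
elim: n b d => [|n IH] b d d0 bX.
  by rewrite big_ord0 divr_ge0// subr_ge0 ltW.
case b0 : (b 0%N).
  apply: (@le_trans _ _ (d / (1 - q))).
    apply: le_trans (sum_geometric_le n.+1 q01 d0).
    apply: ler_sum => j _; case: (b j); rewrite ?mul1r// mul0r.
    by rewrite mulr_ge0// exprn_ge0// ltW.
  rewrite ler_wpM2r ?invr_ge0 ?subr_ge0 ?(ltW q1)//.
  by have := bX 0%N b0; rewrite expr0 mulr1.
rewrite big_ord_recl b0 mul0r add0r.
under eq_bigr do rewrite lift0 exprS (mulrA d).
apply: (IH (fun j => b j.+1)); first by rewrite mulr_ge0// ltW.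
by move=> j bj; have := bX _ bj; rewrite exprS mulrA.
Qed.

Lemma sum_geometric_incr_le b q d X n : 0 < q < 1 -> 0 <= d -> 0 <= X ->
  (forall j, b j -> d / q ^+ j <= X) ->
  \sum_(j < n) (b j)%:R * (d / q ^+ j) <= X / (1 - q).
Proof.
move=> q01 d0 X0 bX; have /andP[q0 q1] := q01.
have qn0 k : q ^+ k != 0 by rewrite expf_neq0// gt_eqF.
case: n => [|n]; first by rewrite big_ord0 divr_ge0// subr_ge0 ltW.
(* read backwards, the sum decreases geometrically *)
rewrite (reindex_inj rev_ord_inj)/=.
have E (j : 'I_n.+1) : d / q ^+ (n.+1 - j.+1) = d / q ^+ n * q ^+ j.
  have -> : q ^+ n = q ^+ (n - j) * q ^+ j by rewrite -exprD subnK// leq_ord.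
  by rewrite subSS invfM -!mulrA mulVf// mulr1.
pose b' j := (j < n.+1)%N && b (n.+1 - j.+1)%N.
rewrite (eq_bigr (fun j : 'I_n.+1 => (b' j)%:R * (d / q ^+ n * q ^+ j))).
  apply: sum_geometric_decr_le => //.
    by rewrite divr_ge0// exprn_ge0// ltW.
  by move=> j /andP[jn bj]; rewrite -(E (Ordinal jn)) bX.
by move=> j _; rewrite E /b' ltn_ord.
Qed.

(** A finite substitute for the layer-cake formula, by which an integral
against $y^{th}$ becomes a sum over the level sets of [y]: either [y] lies
below the last step, or it reaches one of the levels [s j.+1], and then it is
at most [s j] for the first such [j]. *)
Lemma powR_le_staircase (s : nat -> R) (th y : R) n : 0 <= th ->
  (forall j, 0 <= s j) -> 0 <= y -> y <= s 0%N ->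
  y `^ th <= \sum_(j < n) (s j.+1 <= y)%R%:R * s j `^ th + s n `^ th.
Proof.
move=> th0 s0 y0 ys; elim: n => [|n IH].
  by rewrite big_ord0 add0r ge0_ler_powR ?nnegrE.
rewrite big_ord_recr/=; have [sy|ys'] := leP (s n.+1) y.
  by apply: (le_trans IH); rewrite mul1r lerDl powR_ge0.
apply: (@le_trans _ _ (s n.+1 `^ th)).
  by rewrite ge0_ler_powR ?nnegrE// ltW.
by rewrite lerDr mul0r addr0 sumr_ge0// => j _; rewrite mulr_ge0 ?powR_ge0.
Qed.

(** The two halves are geometric sums whose largest term is comparable to a
power of [x]: the first one decreases and starts at [t 2^j >= x], the second
one increases and stops at [t 2^j < x]. *)
Lemma dyadic_split_sum_le (a A t x : R) n : 1 < a < 2 -> 0 < A -> 0 < t ->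
  0 <= x ->
  \sum_(j < n) (A / (t * 2 ^+ j)) `^ (2 - a) *
    (2 * ((x <= t * 2 ^+ j)%R%:R * x ^+ 2) +
     2 * (2 * (t * 2 ^+ j) / A) `^ a * (t * 2 ^+ j) `^ (1 - a) * A `^ a *
       ((t * 2 ^+ j < x)%R%:R * x)) <=
  (2 / (1 - 2 `^ (a - 2)) + 2 * 2 `^ a / (1 - 2 `^ (1 - a))) *
    A `^ (2 - a) * x `^ a.
Proof.
move=> /andP[a1 a2] A0 t0; rewrite le_eqVlt => /predU1P[<-|x0].
  rewrite big1; last by move=> j _; rewrite expr0n/= !mulr0 addr0 mulr0.
  by rewrite powR0 ?mulr0// gt_eqF//; lra.
have q1 : 0 < (2 : R) `^ (a - 2) < 1.
  by rewrite powR_gt0//= powR2_lt1//; lra.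
have q2 : 0 < (2 : R) `^ (1 - a) < 1.
  by rewrite powR_gt0//= powR2_lt1//; lra.
have tj0 j : 0 < t * 2 ^+ j by rewrite mulr_gt0// exprn_gt0.
have two_powR j e : ((2 : R) ^+ j) `^ e = (2 `^ e) ^+ j.
  by rewrite -powR_mulrn// powRAC powR_mulrn// powR_ge0.
have S1 : \sum_(j < n) (x <= t * 2 ^+ j)%R%:R *
    (t `^ (a - 2) * (2 `^ (a - 2)) ^+ j) <= x `^ (a - 2) / (1 - 2 `^ (a - 2)).
  apply: (@sum_geometric_decr_le (fun j => x <= t * 2 ^+ j)) => //.
  - exact: powR_ge0.
  - exact: powR_ge0.
  move=> j xj; rewrite -two_powR -powRM ?exprn_ge0 ?(ltW t0)//.
  rewrite -[a - 2]opprB !powRN lef_pV2 ?posrE ?powR_gt0//.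
  by rewrite ge0_ler_powR ?nnegrE// ?ltW//; lra.
have S2 : \sum_(j < n) (t * 2 ^+ j < x)%R%:R *
    (t `^ (a - 1) / (2 `^ (1 - a)) ^+ j) <= x `^ (a - 1) / (1 - 2 `^ (1 - a)).
  apply: (@sum_geometric_incr_le (fun j => t * 2 ^+ j < x)) => //.
  - exact: powR_ge0.
  - exact: powR_ge0.
  move=> j xj; rewrite -two_powR -powRN opprB -powRM ?exprn_ge0 ?(ltW t0)//.
  by rewrite ge0_ler_powR ?nnegrE// ?ltW//; lra.
have E j : (A / (t * 2 ^+ j)) `^ (2 - a) *
    (2 * ((x <= t * 2 ^+ j)%R%:R * x ^+ 2) +
     2 * (2 * (t * 2 ^+ j) / A) `^ a * (t * 2 ^+ j) `^ (1 - a) * A `^ a *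
       ((t * 2 ^+ j < x)%R%:R * x)) =
   2 * A `^ (2 - a) * x ^+ 2 * ((x <= t * 2 ^+ j)%R%:R *
    (t `^ (a - 2) * (2 `^ (a - 2)) ^+ j)) +
   2 * 2 `^ a * A `^ (2 - a) * x * ((t * 2 ^+ j < x)%R%:R *
    (t `^ (a - 1) / (2 `^ (1 - a)) ^+ j)).
  rewrite -!two_powR -powRN opprB -!powRM ?exprn_ge0 ?(ltW t0)//.
  move: (t * 2 ^+ j) (tj0 j) => u u0.
  rewrite !powRM ?invr_ge0 ?mulr_ge0 ?(ltW u0) ?(ltW A0)//.
  rewrite -!powR_inv1 ?(ltW u0) ?(ltW A0)// -!powRrM !mulN1r opprB.
  rewrite [A `^ (- a)]powRN.
  have An : A `^ a != 0 by rewrite gt_eqF// powR_gt0.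
  have -> : u `^ (a - 1) = u `^ (a - 2) * u `^ a * u `^ (1 - a).
    rewrite -!powRD ?(gt_eqF u0) ?implybT//; congr (_ `^ _); ring.
  by field.
under eq_bigr do rewrite E.
rewrite big_split/= -!mulr_sumr.
have Ap : 0 <= A `^ (2 - a) := powR_ge0 _ _.
apply: (@le_trans _ _
  (2 * A `^ (2 - a) * x ^+ 2 * (x `^ (a - 2) / (1 - 2 `^ (a - 2))) +
   2 * 2 `^ a * A `^ (2 - a) * x * (x `^ (a - 1) / (1 - 2 `^ (1 - a))))).
  by rewrite lerD// ler_wpM2l// !mulr_ge0 ?powR_ge0 ?exprn_ge0 ?(ltW x0).
have -> : x `^ (a - 1) = x * x `^ (a - 2).
  rewrite -{2}(powRr1 (ltW x0)) -powRD ?(gt_eqF x0) ?implybT//.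
  by congr (_ `^ _); ring.
rewrite le_eqVlt; apply/orP; left; apply/eqP.
have -> : x `^ a = x ^+ 2 * x `^ (a - 2).
  rewrite -powR_mulrn ?(ltW x0)// -powRD ?(gt_eqF x0) ?implybT//.
  by congr (_ `^ _); ring.
ring.
Qed.

End dyadic_sums.

(** * Paley's inequality *)

Section truncation.
Context {R : realType} d (T : measurableType d) (mu : {measure set T -> \bar R}).
Implicit Types (f : T -> cplx R) (D : set T).

Definition L1L2 f := in_Lp mu 1%:E f /\ in_Lp mu 2%:E f.

Definition crestrict D f : T -> cplx R := fun x => (\1_D x : R)%:C * f x.

Lemma normc_crestrict D f x : normc (crestrict D f x) = \1_D x * normc (f x).
Proof. by rewrite /crestrict normcM normc_real ger0_norm. Qed.

Lemma cmeasurable_crestrict D f :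
  measurable D -> cmeasurable f -> cmeasurable (crestrict D f).
Proof.
move=> mD mf; apply: cmeasurableM => //; apply: cmeasurable_real.
exact: measurable_indic.
Qed.

Lemma L1L2_crestrict D f : measurable D -> L1L2 f -> L1L2 (crestrict D f).
Proof.
move=> mD [/in_Lp1P[mf f1] /in_Lp2P[_ f2]].
have mDf := cmeasurable_crestrict mD mf.
have le1 x : normc (crestrict D f x) <= normc (f x).
  by rewrite normc_crestrict ler_piMl ?normc_ge0// indicE; case: (_ \in _).
split; [apply/in_Lp1P|apply/in_Lp2P]; split => //.
  apply: le_lt_trans f1; apply: ge0_le_integral_EFin => //.
  - exact: cmeasurable_normc.
  - exact: cmeasurable_normc.
  - by move=> x; exact: normc_ge0.
apply: le_lt_trans f2; apply: ge0_le_integral_EFin => //.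
- exact/measurable_funX/cmeasurable_normc.
- exact/measurable_funX/cmeasurable_normc.
- by move=> x; exact: sqr_ge0.
- by move=> x; rewrite lerXn2r ?nnegrE ?normc_ge0.
Qed.

Lemma crestrict_split D f : f = (fun x => crestrict D f x + crestrict (~` D) f x).
Proof.
apply/funext => x; rewrite /crestrict !indicE in_setC.
by case: (x \in D); rewrite /= !(mul0r, mul1r, addr0, add0r).
Qed.

Lemma measurable_normc_le f (t : R) :
  cmeasurable f -> measurable [set x | normc (f x) <= t].
Proof.
move=> /cmeasurable_normc mf.
rewrite [X in measurable X](_ : _ =
  [set: T] `&` (fun x => normc (f x)) @^-1` [set` `]-oo, t]]).
  exact: mf.
by rewrite setTI; apply/seteqP; split => x /=; rewrite in_itv.
Qed.

Lemma measurable_normc_ge f (t : R) :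
  cmeasurable f -> measurable [set x | t <= normc (f x)].
Proof.
move=> /cmeasurable_normc mf.
rewrite [X in measurable X](_ : _ =
  [set: T] `&` (fun x => normc (f x)) @^-1` [set` `[t, +oo[]).
  exact: mf.
by rewrite setTI; apply/seteqP; split => x /=; rewrite in_itv/= andbT.
Qed.

End truncation.

Section fourier_like.
Context {R : realType} d1 (X : measurableType d1) d2 (Y : measurableType d2).
Context (lam : {measure set X -> \bar R}) (pi : {measure set Y -> \bar R}).

(** What the multiplier theorem uses of the Fourier transform: the endpoints
of an interpolation between $L^1$ and $L^2$. *)
Record fourier_like (F : (X -> cplx R) -> Y -> cplx R) : Prop := {
  fl_measurable : forall f, L1L2 lam f -> cmeasurable (F f) ;
  flD : forall f g, L1L2 lam f -> L1L2 lam g ->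
    F (fun x => f x + g x) = (fun y => F f y + F g y) ;
  fl_sup : forall f y, L1L2 lam f ->
    ((normc (F f y))%:E <= \int[lam]_x (normc (f x))%:E)%E ;
  fl_L2 : forall f, L1L2 lam f ->
    (\int[lam]_x (normc (f x) ^+ 2)%:E = \int[pi]_y (normc (F f y) ^+ 2)%:E)%E
}.

Context (F : (X -> cplx R) -> Y -> cplx R) (FF : fourier_like F).

Lemma cmeasurable_sqr_normc d (T : measurableType d) (f : T -> cplx R) :
  cmeasurable f -> measurable_fun [set: T] (fun x => normc (f x) ^+ 2).
Proof. by move=> mf; exact/measurable_funX/cmeasurable_normc. Qed.

(** The small part of [f] goes through the $L^2$ isometry and the large part
through the $L^1$-$L^\infty$ bound. The $L^1$ norm of the large part appears
squared; by Chebyshev one factor is at most $t^{1-a}A^a$, and the bound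
becomes linear in it. *)
Lemma truncation_estimate (f : X -> cplx R) (E : set Y) (a t A v : R) :
  L1L2 lam f -> measurable E -> 1 < a -> 0 < t -> 0 <= v ->
  (pi E <= v%:E)%E ->
  (\int[lam]_x (normc (f x) `^ a)%:E <= (A `^ a)%:E)%E ->
  (\int[pi]_y (\1_E y * normc (F f y) ^+ 2)%:E <=
   \int[lam]_x (2 * ((normc (f x) <= t)%R%:R * normc (f x) ^+ 2) +
     2 * v * t `^ (1 - a) * A `^ a * ((t < normc (f x))%R%:R * normc (f x)))%:E)%E.
Proof.
move=> Lf mE a1 t0 v0 piE fa.
have mf : cmeasurable f by case: Lf => /in_Lp1P[].
have mnf := cmeasurable_normc mf.
pose D := [set x | normc (f x) <= t].
have mD : measurable D := measurable_normc_le t mf.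
have DE x : \1_D x = (normc (f x) <= t)%R%:R :> R.
  by rewrite indicE; congr (nat_of_bool _)%:R; apply/idP/idP; rewrite inE.
have DcE x : \1_(~` D) x = (t < normc (f x))%R%:R :> R.
  rewrite indicE ltNge; congr (nat_of_bool _)%:R.
  by rewrite in_setC; congr (~~ _); apply/idP/idP; rewrite inE.
pose g := crestrict D f; pose b := crestrict (~` D) f.
have Lg : L1L2 lam g := L1L2_crestrict mD Lf.
have Lb : L1L2 lam b := L1L2_crestrict (measurableC mD) Lf.
have mb : cmeasurable b by case: Lb => /in_Lp1P[].
have mg : cmeasurable g by case: Lg => /in_Lp1P[].
pose be := fine (\int[lam]_x (normc (b x))%:E).
have beE : (\int[lam]_x (normc (b x))%:E = be%:E)%E.
  rewrite /be fineK// ge0_fin_numE; first by case: Lb => /in_Lp1P[].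
  by apply: integral_ge0_EFin => x; exact: normc_ge0.
have be0 : 0 <= be.
  rewrite -lee_fin -beE; apply: integral_ge0_EFin => x; exact: normc_ge0.
have be_le : be <= t `^ (1 - a) * A `^ a.
  rewrite -lee_fin -beE EFinM.
  apply: (@le_trans _ _ (\int[lam]_x (t `^ (1 - a) * normc (f x) `^ a)%:E)%E).
    apply: ge0_le_integral_EFin.
    - exact: cmeasurable_normc.
    - apply: measurable_funM => //.
      exact: (@measurableT_comp _ _ _ _ _ _ (@powR R ^~ a)).
    - by move=> x; exact: normc_ge0.
    move=> x; rewrite normc_crestrict DcE; case: ltP => [tf|_]; last first.
      by rewrite mul0r mulr_ge0 ?powR_ge0.
    have f0 : 0 < normc (f x) by exact: lt_trans tf.
    rewrite mul1r -(mulr_powRB1 (ltW f0) (lt_trans ltr01 a1)) mulrCA.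
    rewrite ler_peMr ?(ltW f0)// -[1 - a]opprB powRN mulrC.
    rewrite ler_pdivlMr ?powR_gt0// mul1r.
    by rewrite ge0_ler_powR ?nnegrE ?ltW// subr_gt0.
  rewrite ge0_integralZl_real ?powR_ge0//.
    by rewrite lee_pmul2l// lte_fin powR_gt0.
    exact: (@measurableT_comp _ _ _ _ _ _ (@powR R ^~ a)).
  by move=> x; exact: powR_ge0.
apply: (@le_trans _ _ (\int[pi]_y
    (2 * normc (F g y) ^+ 2 + 2 * be ^+ 2 * \1_E y)%:E)%E).
  have mFg := cmeasurable_sqr_normc (fl_measurable FF Lg).
  apply: ge0_le_integral_EFin.
  - apply: measurable_funM; first exact: measurable_indic.
    exact: cmeasurable_sqr_normc (fl_measurable FF Lf).
  - apply: measurable_funD; first exact: measurable_funM.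
    by apply: measurable_funM => //; exact: measurable_indic.
  - by move=> y; rewrite mulr_ge0 ?sqr_ge0.
  move=> y; rewrite {1}(crestrict_split D f) flD// -/g -/b.
  have Fb : normc (F b y) <= be by rewrite -lee_fin -beE; exact: fl_sup.
  have := sqr_normcD (F g y) (F b y).
  have : normc (F b y) ^+ 2 <= be ^+ 2 by rewrite lerXn2r ?nnegrE ?normc_ge0.
  have := sqr_ge0 (normc (F g y)).
  rewrite indicE; case: (y \in E) => /=; last by lra.
  by rewrite mul1r; lra.
rewrite ge0_integralD_EFin; last 4 first.
  - apply: measurable_funM => //.
    exact: cmeasurable_sqr_normc (fl_measurable FF Lg).
  - by apply: measurable_funM => //; exact: measurable_indic.
  - by move=> y; rewrite mulr_ge0 ?sqr_ge0.
  - by move=> y; rewrite mulr_ge0 ?mulr_ge0 ?sqr_ge0.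
rewrite ge0_integralZl_real//; last 2 first.
  - exact: cmeasurable_sqr_normc (fl_measurable FF Lg).
  - by move=> y; exact: sqr_ge0.
rewrite -(fl_L2 FF Lg) ge0_integralZl_real ?mulr_ge0 ?sqr_ge0//.
rewrite integral_indic// setIT.
rewrite ge0_integralD_EFin; last 4 first.
  - apply: measurable_funM => //; under eq_fun do rewrite -DE.
    by apply: measurable_funM; [exact: measurable_indic|exact: measurable_funX].
  - apply: measurable_funM => //; under eq_fun do rewrite -DcE -normc_crestrict.
    exact: cmeasurable_normc.
  - by move=> x; rewrite !mulr_ge0 ?sqr_ge0 ?normc_ge0.
  - by move=> x; rewrite !mulr_ge0 ?powR_ge0 ?normc_ge0.
apply: leeD.
  rewrite -ge0_integralZl_real//; last 2 first.
  - exact: cmeasurable_sqr_normc.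
  - by move=> x; exact: sqr_ge0.
  under eq_integral do rewrite normc_crestrict exprMn DE.
  rewrite le_eqVlt; apply/orP; left; apply/eqP; apply: eq_integral => x _.
  by case: (normc (f x) <= t)%R; rewrite ?expr1n// expr0n.
under [leRHS]eq_integral do rewrite -DcE -normc_crestrict.
rewrite ge0_integralZl_real; last 3 first.
- exact: cmeasurable_normc.
- by move=> x; exact: normc_ge0.
- by rewrite !mulr_ge0 ?powR_ge0.
rewrite -/b beE; apply: (@le_trans _ _ ((2 * be ^+ 2)%:E * v%:E)%E).
  by rewrite lee_wpmul2l// lee_fin mulr_ge0 ?sqr_ge0.
rewrite -!EFinM lee_fin.
rewrite (_ : 2 * be ^+ 2 * v = 2 * v * be * be); last by ring.
by rewrite ler_wpM2r// -!mulrA !ler_wpM2l.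
Qed.

(** Paley's inequality in its $L^2$ form: a weight [phi] of weak $L^1$ norm at
most one is allowed in Plancherel's identity, at the price of replacing the
$L^2$ norm of [f] by its $L^a$ norm. The weight is cut along the levels
$(A/t_j)^a$ and, on the [j]-th level set, [f] is cut at the height
$t_j = 2^j t_0$; both parts then add up to geometric sums. *)
Lemma paley_inequality (a : R) : 1 < a -> a <= 2 ->
  exists2 C : R, 0 < C & forall (f : X -> cplx R) (phi : Y -> R) (A B : R),
    L1L2 lam f -> measurable_fun [set: Y] phi -> (forall y, 0 <= phi y) ->
    0 < B -> {ae pi, forall y, phi y <= B} ->
    (forall s : R, 0 < s -> (pi [set y | (s <= phi y)%R] <= (s^-1)%:E)%E) ->
    0 < A -> (\int[lam]_x (normc (f x) `^ a)%:E <= (A `^ a)%:E)%E ->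
    (\int[pi]_y (phi y `^ ((2 - a) / a) * normc (F f y) ^+ 2)%:E <=
     (C * A ^+ 2)%:E)%E.
Proof.
move=> a1; rewrite le_eqVlt => /predU1P[->|a2].
  exists 1 => // f phi A B Lf mphi phi0 B0 phiB levels A0.
  rewrite subrr mul0r powR_mulrn ?(ltW A0)// mul1r.
  under eq_integral do rewrite powR_mulrn ?normc_ge0//.
  by rewrite (fl_L2 FF Lf) => fA; under eq_integral do rewrite powRr0 mul1r.
have a0 : 0 < a by rewrite (lt_trans ltr01).
have an0 : a != 0 by rewrite gt_eqF.
pose C0 : R := 2 / (1 - 2 `^ (a - 2)) + 2 * 2 `^ a / (1 - 2 `^ (1 - a)).
have q1 : (2 : R) `^ (a - 2) < 1 by apply: powR2_lt1; lra.
have q2 : (2 : R) `^ (1 - a) < 1 by apply: powR2_lt1; lra.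
have C00 : 0 < C0.
  by rewrite addr_gt0// divr_gt0 ?subr_gt0// mulr_gt0// powR_gt0.
exists (C0 + 1); first by rewrite addr_gt0.
move=> f phi A B Lf mphi phi0 B0 phiB levels A0 fa.
have mf : cmeasurable f by case: Lf => /in_Lp1P[].
have mF := cmeasurable_sqr_normc (fl_measurable FF Lf).
pose th := (2 - a) / a.
have th0 : 0 <= th by rewrite divr_ge0// ?(ltW a0)//; lra.
(* chosen so that the top level [s 0] is the bound [B] of [phi] *)
pose t0 := A * B `^ (- a^-1); have t00 : 0 < t0 by rewrite mulr_gt0// powR_gt0.
pose t j := t0 * 2 ^+ j; have tj0 j : 0 < t j by rewrite mulr_gt0// exprn_gt0.
have At0 j : 0 < A / t j by rewrite divr_gt0.
pose s j := (A / t j) `^ a; have s0 j : 0 < s j by rewrite powR_gt0.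
have sth j : s j `^ th = (A / t j) `^ (2 - a).
  by rewrite /s /th -powRrM mulrCA divff// mulr1.
have s0B : s 0%N = B.
  rewrite /s /t expr0 mulr1 /t0 invfM mulrA divff ?(gt_eqF A0)// mul1r.
  by rewrite powRN invrK -powRrM mulVf// powRr1// ltW.
pose K := fine (\int[lam]_x (normc (f x) ^+ 2)%:E)%E.
have KE : (\int[lam]_x (normc (f x) ^+ 2)%:E = K%:E)%E.
  rewrite /K fineK// ge0_fin_numE; first by case: Lf => _ /in_Lp2P[].
  by apply: integral_ge0_EFin => x; exact: sqr_ge0.
have K0 : 0 <= K.
  by rewrite -lee_fin -KE; apply: integral_ge0_EFin => x; exact: sqr_ge0.
(* [n] is so large that the last step of the staircase costs at most [A ^ 2] *)
have [n nK] : exists n, s n `^ th * K <= A ^+ 2.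
  pose D := (A / t0) `^ (2 - a) * K + 1.
  have D0 : 0 < D by rewrite ltr_wpDl// mulr_ge0// powR_ge0.
  have : `|2 `^ (a - 2)| < 1 :> R by rewrite ger0_norm ?powR_ge0.
  move/cvg_expr/cvgrPdist_lt => /(_ (A ^+ 2 / D)).
  rewrite divr_gt0 ?exprn_gt0// => /(_ isT) [n _ /(_ n (leqnn n))] /=.
  rewrite sub0r normrN ger0_norm ?exprn_ge0 ?powR_ge0// ltr_pdivlMr// => nD.
  exists n; rewrite sth /t invfM mulrA powRM ?invr_ge0 ?exprn_ge0//; last first.
    by rewrite divr_ge0// ltW.
  rewrite -powR_mulrn// -powRN -powRrM mulNr -mulrN opprB mulrC powRrM.
  rewrite powRAC powR_mulrn ?powR_ge0//.
  apply: le_trans (ltW nD); rewrite mulrC mulrAC mulrC ler_wpM2l//.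
  by rewrite /D lerDl.
pose E j := [set y | s j.+1 <= phi y].
have mE j : measurable (E j).
  rewrite [X in measurable X](_ : _ =
    [set: Y] `&` phi @^-1` [set` `[s j.+1, +oo[]).
    exact: mphi.
  by rewrite setTI; apply/seteqP; split => x /=; rewrite in_itv/= andbT.
pose v j := (2 * t j / A) `^ a.
have piE j : (pi (E j) <= (v j)%:E)%E.
  apply: le_trans (levels _ (s0 _)) _; rewrite lee_fin /s /v -powRN.
  rewrite le_eqVlt; apply/orP; left; apply/eqP.
  by rewrite powRN -powR_inv1 ?powR_ge0// powRAC powR_inv1 ?divr_ge0 ?(ltW A0)
    ?(ltW (tj0 _))// invf_div /t exprS mulrCA.
pose G j x := 2 * ((normc (f x) <= t j)%R%:R * normc (f x) ^+ 2) +
  2 * v j * t j `^ (1 - a) * A `^ a * ((t j < normc (f x))%R%:R * normc (f x)).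
have mG j : measurable_fun [set: X] (G j).
  have mnf := cmeasurable_normc mf.
  apply: measurable_funD; apply: measurable_funM => //; apply: measurable_funM => //.
  - apply: (measurableT_comp (f := fun b : bool => b%:R : R)) => //.
    exact: measurable_fun_ler.
  - exact: measurable_funX.
  - apply: (measurableT_comp (f := fun b : bool => b%:R : R)) => //.
    exact: measurable_fun_ltr.
have G0 j x : 0 <= G j x.
  by rewrite /G addr_ge0// !mulr_ge0 ?powR_ge0 ?exprn_ge0 ?normc_ge0.
have trunc j : (\int[pi]_y (\1_(E j) y * normc (F f y) ^+ 2)%:E <=
    \int[lam]_x (G j x)%:E)%E.
  by apply: truncation_estimate; rewrite ?powR_ge0.
pose step j y := s j `^ th * (\1_(E j) y * normc (F f y) ^+ 2).
have mstep j : measurable_fun [set: Y] (step j).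
  by apply: measurable_funM => //; apply: measurable_funM => //;
    exact: measurable_indic.
have step0 j y : 0 <= step j y by rewrite !mulr_ge0 ?powR_ge0 ?normc_ge0.
apply: (@le_trans _ _ (\int[pi]_y
    (\sum_(j < n) step j y + s n `^ th * normc (F f y) ^+ 2)%:E)%E).
  apply: ae_ge0_le_integral => //.
  - by move=> y _; rewrite lee_fin mulr_ge0 ?powR_ge0 ?sqr_ge0.
  - apply/measurable_EFinP; apply: measurable_funM => //.
    exact: (@measurableT_comp _ _ _ _ _ _ (@powR R ^~ th)).
  - move=> y _; rewrite lee_fin addr_ge0// ?mulr_ge0 ?powR_ge0 ?normc_ge0//.
    by apply: sumr_ge0.
  - apply/measurable_EFinP; apply: measurable_funD; last exact: measurable_funM.
    exact: measurable_sum.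
  apply: filterS phiB => y phiB _; rewrite lee_fin.
  rewrite -s0B in phiB.
  have := powR_le_staircase n th0 (fun j => ltW (s0 j)) (phi0 y) phiB.
  move=> /(ler_wpM2r (sqr_ge0 (normc (F f y)))) /le_trans; apply.
  rewrite mulrDl lerD2r mulr_suml; apply: ler_sum => j _.
  rewrite /step indicE (_ : (y \in E j) = (s j.+1 <= phi y)).
    by rewrite [leRHS]mulrCA [leRHS]mulrA.
  by apply/idP/idP; rewrite inE.
rewrite ge0_integralD_EFin; last 4 first.
  - exact: measurable_sum.
  - exact: measurable_funM.
  - by move=> y; apply: sumr_ge0.
  - by move=> y; rewrite mulr_ge0 ?powR_ge0 ?sqr_ge0.
rewrite mulrDl mul1r EFinD; apply: leeD; last first.
  rewrite ge0_integralZl_real ?powR_ge0//; last by move=> y; exact: sqr_ge0.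
  by rewrite -(fl_L2 FF Lf) KE -EFinM lee_fin.
rewrite ge0_integral_sum_EFin//.
apply: (@le_trans _ _ (\sum_(j < n) \int[lam]_x (s j `^ th * G j x)%:E)%E).
  apply: lee_sum => j _; rewrite !ge0_integralZl_real ?powR_ge0//.
  - by rewrite lee_wpmul2l// lee_fin powR_ge0.
  - by apply: measurable_funM => //; exact: measurable_indic.
  - by move=> y; rewrite mulr_ge0 ?sqr_ge0.
rewrite -(@ge0_integral_sum_EFin _ _ _ lam n
  (fun j x => s j `^ th * G j x)); last 2 first.
  - by move=> j; exact: measurable_funM.
  - by move=> j x; rewrite mulr_ge0// powR_ge0.
have mfa : measurable_fun [set: X] (fun x => normc (f x) `^ a).
  exact: (@measurableT_comp _ _ _ _ _ _ (@powR R ^~ a)) (cmeasurable_normc mf).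
apply: (@le_trans _ _
    (\int[lam]_x (C0 * A `^ (2 - a) * normc (f x) `^ a)%:E)%E).
  apply: ge0_le_integral_EFin.
  - by apply: measurable_sum => j; exact: measurable_funM.
  - exact: measurable_funM.
  - by move=> x; apply: sumr_ge0 => j _; rewrite mulr_ge0// powR_ge0.
  move=> x; under eq_bigr do rewrite sth.
  by apply: dyadic_split_sum_le; rewrite ?a1 ?normc_ge0.
rewrite ge0_integralZl_real//; last 2 first.
- by move=> x; exact: powR_ge0.
- by rewrite mulr_ge0 ?powR_ge0// ltW.
apply: (@le_trans _ _ ((C0 * A `^ (2 - a))%:E * (A `^ a)%:E)%E).
  by rewrite lee_wpmul2l// lee_fin mulr_ge0 ?powR_ge0// ltW.
rewrite -EFinM lee_fin -mulrA -powRD; last by rewrite (gt_eqF A0) implybT.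
by rewrite subrK powR_mulrn// ltW.
Qed.

End fourier_like.

(** * The bilinear form of a multiplier *)

Section weighted_product.
Context {R : realType} d (Y : measurableType d) (pi : {measure set Y -> \bar R}).

(** The geometric-arithmetic mean inequality, with the two terms balanced by
the factor [B / A], plays the role of the Cauchy-Schwarz inequality. *)
Lemma weighted_product_le (h w1 w2 u v : Y -> R) (N C1 C2 A B : R) :
  measurable_fun [set: Y] h -> measurable_fun [set: Y] w1 ->
  measurable_fun [set: Y] w2 -> measurable_fun [set: Y] u ->
  measurable_fun [set: Y] v ->
  (forall y, 0 <= h y) -> (forall y, 0 <= u y) -> (forall y, 0 <= v y) ->
  0 <= N -> 0 < A -> 0 < B ->
  {ae pi, forall y, h y <= N * (w1 y * w2 y)} ->
  (\int[pi]_y (w1 y ^+ 2 * u y ^+ 2)%:E <= (C1 * A ^+ 2)%:E)%E ->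
  (\int[pi]_y (w2 y ^+ 2 * v y ^+ 2)%:E <= (C2 * B ^+ 2)%:E)%E ->
  (\int[pi]_y (h y * u y * v y)%:E <= (N * (C1 + C2) * A * B)%:E)%E.
Proof.
move=> mh mw1 mw2 mu mv h0 u0 v0 N0 A0 B0 hw I1 I2.
have c0 : 0 < B / A by rewrite divr_gt0.
have m1 : measurable_fun [set: Y] (fun y => w1 y ^+ 2 * u y ^+ 2).
  by apply: measurable_funM; exact: measurable_funX.
have m2 : measurable_fun [set: Y] (fun y => w2 y ^+ 2 * v y ^+ 2).
  by apply: measurable_funM; exact: measurable_funX.
have p1 y : 0 <= w1 y ^+ 2 * u y ^+ 2 by rewrite -exprMn sqr_ge0.
have p2 y : 0 <= w2 y ^+ 2 * v y ^+ 2 by rewrite -exprMn sqr_ge0.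
have NA0 : 0 <= N * (B / A) by rewrite mulr_ge0// ltW.
have NB0 : 0 <= N * (A / B) by rewrite mulr_ge0// divr_ge0// ltW.
apply: (@le_trans _ _ (\int[pi]_y (N * (B / A) * (w1 y ^+ 2 * u y ^+ 2) +
    N * (A / B) * (w2 y ^+ 2 * v y ^+ 2))%:E)%E).
  apply: ae_ge0_le_integral => //.
  - by move=> y _; rewrite lee_fin !mulr_ge0.
  - by apply/measurable_EFinP/measurable_funM => //; exact: measurable_funM.
  - by move=> y _; rewrite lee_fin addr_ge0// mulr_ge0.
  - by apply/measurable_EFinP/measurable_funD; exact: measurable_funM.
  apply: filterS hw => y hy _; rewrite lee_fin.
  apply: (@le_trans _ _ (N * (w1 y * w2 y) * u y * v y)).
    by rewrite ler_wpM2r// ler_wpM2r.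
  rewrite -subr_ge0 [leRHS](_ : _ = N * (B / A) / 2 *
      ((w1 y * u y - A / B * (w2 y * v y)) ^+ 2 +
       (w1 y * u y) ^+ 2 + (A / B * (w2 y * v y)) ^+ 2)); last first.
    by field; rewrite (gt_eqF A0) (gt_eqF B0).
  by rewrite mulr_ge0 ?divr_ge0// !addr_ge0 ?sqr_ge0.
rewrite ge0_integralD_EFin; last 4 first.
- exact: measurable_funM.
- exact: measurable_funM.
- by move=> y; rewrite mulr_ge0.
- by move=> y; rewrite mulr_ge0.
rewrite !ge0_integralZl_real//.
apply: (@le_trans _ _ ((N * (B / A))%:E * (C1 * A ^+ 2)%:E +
    (N * (A / B))%:E * (C2 * B ^+ 2)%:E)%E).
  by apply: leeD; rewrite lee_wpmul2l.
rewrite -!EFinM -EFinD lee_fin le_eqVlt; apply/orP; left; apply/eqP.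
by field; rewrite (gt_eqF A0) (gt_eqF B0).
Qed.

End weighted_product.

Section bilinear_bound.
Context {R : realType} d1 (X : measurableType d1) d2 (Y : measurableType d2).
Context (lam : {measure set X -> \bar R}) (pi : {measure set Y -> \bar R}).
Context (F : (X -> cplx R) -> Y -> cplx R) (FF : fourier_like lam pi F).

(** For $\rho = 1/a + 1/b - 1 > 0$ the function
$\phi = (|h|/M)^{1/\rho}$ has weak $L^1$ norm at most one, and
$|h| = M \phi^{1/a-1/2} \phi^{1/b-1/2}$ splits it into the weights that
Paley's inequality allows for [f] and for [k]. If $\rho = 0$, then
$a = b = 2$, the symbol is essentially bounded by $M$, and Plancherel's
identity suffices. *)
Lemma multiplier_form_le (a b : R) : 1 < a -> a <= 2 -> 1 < b -> b <= 2 ->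
  exists2 C : R, 0 < C &
    forall (h : Y -> cplx R) (f k : X -> cplx R) (M A B B0 : R),
    cmeasurable h -> {ae pi, forall y, normc (h y) <= B0} -> 0 < M ->
    (forall s : R, 0 < s -> pi [set y | (s <= normc (h y))%R] = 0%E \/
      (s%:E * pi [set y | (s <= normc (h y))%R] `^ (a^-1 + b^-1 - 1) <=
       M%:E)%E) ->
    L1L2 lam f -> L1L2 lam k -> 0 < A -> 0 < B ->
    (\int[lam]_x (normc (f x) `^ a)%:E <= (A `^ a)%:E)%E ->
    (\int[lam]_x (normc (k x) `^ b)%:E <= (B `^ b)%:E)%E ->
    (\int[pi]_y (normc (h y) * normc (F f y) * normc (F k y))%:E <=
     (C * M * A * B)%:E)%E.
Proof.
move=> a1 a2 b1 b2.
have [Ca Ca0 paleya] := paley_inequality FF a1 a2.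
have [Cb Cb0 paleyb] := paley_inequality FF b1 b2.
have a0 : 0 < a by rewrite (lt_trans ltr01).
have b0 : 0 < b by rewrite (lt_trans ltr01).
have an0 : a != 0 by rewrite gt_eqF.
have bn0 : b != 0 by rewrite gt_eqF.
(* the summand 4 serves the case [rho = 0] *)
exists (Ca + Cb + 4); first by rewrite !addr_gt0.
move=> h f k M A B B0 mh hB M0 weak Lf Lk A0 B00 fa kb.
have mnh := cmeasurable_normc mh.
have mFf := cmeasurable_normc (fl_measurable FF Lf).
have mFk := cmeasurable_normc (fl_measurable FF Lk).
have th a' : 1 < a' -> a' <= 2 -> 0 <= (2 - a') / a' :> R.
  by move=> ? ?; rewrite divr_ge0//; lra.
set rho := a^-1 + b^-1 - 1 in weak.
have rhoE : rho = ((2 - a) / a) / 2 + ((2 - b) / b) / 2.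
  by rewrite /rho; field; rewrite an0 bn0.
have : 0 <= rho by rewrite rhoE addr_ge0// divr_ge0// th.
rewrite le_eqVlt => /predU1P[rho0|rho0].
  have [tha thb] : (2 - a) / a = 0 /\ (2 - b) / b = 0.
    by have := th _ a1 a2; have := th _ b1 b2; split; lra.
  have a2E : a = 2.
    move/eqP: tha.
    by rewrite mulf_eq0 invr_eq0 (negbTE an0) orbF subr_eq0 => /eqP.
  have b2E : b = 2.
    move/eqP: thb.
    by rewrite mulf_eq0 invr_eq0 (negbTE bn0) orbF subr_eq0 => /eqP.
  have isom (g : X -> cplx R) (D : R) : L1L2 lam g -> 0 < D ->
      (\int[lam]_x (normc (g x) `^ 2)%:E <= (D `^ 2)%:E)%E ->
      (\int[pi]_y (cst 1 y ^+ 2 * normc (F g y) ^+ 2)%:E <= (1 * D ^+ 2)%:E)%E.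
    move=> Lg D0; rewrite powR_mulrn ?(ltW D0)//.
    under eq_integral do rewrite powR_mulrn ?normc_ge0//.
    rewrite (fl_L2 FF Lg) mul1r => gD.
    by under eq_integral do rewrite expr1n mul1r.
  apply: (@le_trans _ _ (2 * M * (1 + 1) * A * B)%:E); last first.
    rewrite lee_fin !ler_wpM2r ?(ltW A0) ?(ltW B00)//.
    rewrite [leLHS](_ : _ = 4 * M); last by ring.
    by rewrite ler_wpM2r ?(ltW M0)// lerDr addr_ge0// ltW.
  apply: (@weighted_product_le _ _ _ _ _ (cst 1) (cst 1)) => //.
  - by move=> y; exact: normc_ge0.
  - by move=> y; exact: normc_ge0.
  - by move=> y; exact: normc_ge0.
  - by rewrite mulr_ge0// ltW.
  - (* the level [2 M] rather than [M]: there the alternative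
       [2 * M <= M] of the hypothesis fails, so the level set is null *)
    have M20 : 0 < 2 * M by rewrite mulr_gt0.
    have [null|] := weak _ M20; last first.
      by rewrite -rho0 poweRe0 mule1 lee_fin => ?; exfalso; lra.
    exists [set y | 2 * M <= normc (h y)]; split => //.
      exact: measurable_normc_ge.
    move=> y /= ny; apply: contrapT => /negP; rewrite -ltNge => /ltW hy.
    by apply: ny; rewrite /cst !mulr1.
  - by apply: isom => //; rewrite -a2E.
  - by apply: isom => //; rewrite -b2E.
pose phi y := (normc (h y) / M) `^ rho^-1.
have rhon0 : rho != 0 by rewrite gt_eqF.
have mphi : measurable_fun [set: Y] phi.
  apply: (@measurableT_comp _ _ _ _ _ _ (@powR R ^~ rho^-1)) => //.
  exact: measurable_funM.
have phi0 y : 0 <= phi y by exact: powR_ge0.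
have hM y : 0 <= normc (h y) / M by rewrite divr_ge0 ?normc_ge0// ltW.
have phirho y : phi y `^ rho = normc (h y) / M.
  by rewrite /phi -powRrM mulVf// powRr1.
have levels s : 0 < s -> (pi [set y | (s <= phi y)%R] <= (s^-1)%:E)%E.
  move=> s0; have Ms0 : 0 < M * s `^ rho by rewrite mulr_gt0// powR_gt0.
  have -> : [set y | s <= phi y] = [set y | M * s `^ rho <= normc (h y)].
    apply/seteqP; split => y /=.
      move=> sy; rewrite mulrC -ler_pdivlMr// -phirho.
      by rewrite ge0_ler_powR ?nnegrE ?(ltW rho0) ?(ltW s0).
    rewrite mulrC -ler_pdivlMr// => sy.
    rewrite -(powRr1 (ltW s0)) -(divff rhon0) powRrM /phi.
    by rewrite ge0_ler_powR ?nnegrE ?powR_ge0 ?invr_ge0 ?(ltW rho0).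
  have [->|] := weak _ Ms0; first by rewrite lee_fin invr_ge0 ltW.
  have : (0 <= pi [set y | (M * s `^ rho <= normc (h y))%R])%E by [].
  case: (pi _) => [v||]//.
    rewrite lee_fin => v0; rewrite poweR_EFin -EFinM lee_fin -mulrA.
    rewrite ger_pMr// => sv.
    have -> : v = (v `^ rho) `^ rho^-1 by rewrite -powRrM divff// powRr1.
    have -> : s^-1 = (s `^ rho)^-1 `^ rho^-1.
      by rewrite -powRN -powRrM mulNr divff// powR_inv1// ltW.
    rewrite lee_fin ge0_ler_powR ?nnegrE ?powR_ge0 ?invr_ge0 ?powR_ge0 ?(ltW rho0)//.
    by rewrite -[leRHS]mul1r ler_pdivlMr ?powR_gt0// mulrC.
  move=> _; rewrite poweRyr// mulry gtr0_sg// mul1e leye_eq//.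
pose D := (`|B0| / M) `^ rho^-1 + 1.
have D0 : 0 < D by rewrite ltr_wpDl ?powR_ge0.
have phiD : {ae pi, forall y, phi y <= D}.
  apply: filterS hB => y hy; rewrite (@le_trans _ _ ((`|B0| / M) `^ rho^-1))//.
    rewrite /phi ge0_ler_powR ?nnegrE ?invr_ge0 ?(ltW rho0)//.
      by rewrite divr_ge0// ltW.
    by rewrite ler_pM2r ?invr_gt0// (le_trans hy)// ler_norm.
  by rewrite /D lerDl.
pose w (e : R) y := phi y `^ (e / 2).
have mw e : measurable_fun [set: Y] (w e).
  exact: (@measurableT_comp _ _ _ _ _ _ (@powR R ^~ _)).
have w2 e y : w e y ^+ 2 = phi y `^ e.
  by rewrite /w -powR_mulrn ?powR_ge0// -powRrM divfK.
apply: (@le_trans _ _ (M * (Ca + Cb) * A * B)%:E); last first.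
  rewrite lee_fin !ler_wpM2r ?(ltW A0) ?(ltW B00)//.
  by rewrite mulrC ler_wpM2r ?(ltW M0)// lerDl.
apply: (@weighted_product_le _ _ _ _ _ (w ((2 - a) / a)) (w ((2 - b) / b))) => //.
- by move=> y; exact: normc_ge0.
- by move=> y; exact: normc_ge0.
- by move=> y; exact: normc_ge0.
- exact: ltW.
- apply: nearW => y; rewrite /w -powRD; last by rewrite -rhoE (negbTE rhon0).
  by rewrite -rhoE phirho mulrC divfK ?(gt_eqF M0).
- under eq_integral do rewrite w2.
  exact: paleya Lf mphi phi0 D0 phiD levels A0 fa.
- under eq_integral do rewrite w2.
  exact: paleyb Lk mphi phi0 D0 phiD levels B00 kb.
Qed.

End bilinear_bound.

(** * Duality *)

Section truncation_limit.
Context {R : realType} d (T : measurableType d) (mu : {measure set T -> \bar R}).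
Implicit Type f : T -> cplx R.

Lemma measurable_normc_powR f (e : R) :
  cmeasurable f -> measurable_fun [set: T] (fun x => normc (f x) `^ e).
Proof.
move=> /cmeasurable_normc.
exact: (@measurableT_comp _ _ _ _ _ _ (@powR R ^~ e)).
Qed.

Lemma measurable_normc_between f (s t : R) :
  cmeasurable f -> measurable [set x | s <= normc (f x) <= t].
Proof.
move=> mf; rewrite [X in measurable X](_ : _ =
  [set x | s <= normc (f x)] `&` [set x | normc (f x) <= t]).
  by apply: measurableI; [exact: measurable_normc_ge|exact: measurable_normc_le].
by apply/seteqP; split => x /= => [/andP//|[a b]]; apply/andP.
Qed.

Lemma truncation_cvg f (e : R) : cmeasurable f -> e != 0 ->
  (\int[mu]_x (\1_[set x | n.+1%:R^-1 <= normc (f x) <= n.+1%:R] x *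
     normc (f x) `^ e)%:E)%E @[n --> \oo] -->
  (\int[mu]_x (normc (f x) `^ e)%:E)%E.
Proof.
move=> mf e0.
pose D (n : nat) := [set x | n.+1%:R^-1 <= normc (f x) <= n.+1%:R].
have mD n : measurable (D n) by exact: measurable_normc_between.
pose g n x := (\1_(D n) x * normc (f x) `^ e)%:E.
have mg n : measurable_fun [set: T] (g n).
  apply/measurable_EFinP/measurable_funM; first exact: measurable_indic.
  exact: measurable_normc_powR.
have g0 n x : [set: T] x -> (0 <= g n x)%E by rewrite lee_fin mulr_ge0 ?powR_ge0.
have ndg x : [set: T] x -> nondecreasing_seq (g ^~ x).
  move=> _ i j ij; rewrite lee_fin ler_wpM2r ?powR_ge0// !indicE ler_nat.
  case: (boolP (x \in D i)) => // /set_mem /= /andP[ix xi].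
  rewrite mem_set//=; apply/andP; split; last by rewrite (le_trans xi)// ler_nat.
  by apply: le_trans ix; rewrite lef_pV2 ?posrE ?ltr0n// ler_nat.
have limg x : limn (g ^~ x) = (normc (f x) `^ e)%:E.
  apply: cvg_lim => //; have [f0|f0] := eqVneq (normc (f x)) 0.
    rewrite f0 powR0//; rewrite (_ : g ^~ x = cst 0%E); first exact: cvg_cst.
    by apply/funext => n; rewrite /g f0 powR0// mulr0.
  have up : 0 < normc (f x) by rewrite lt_def f0 normc_ge0.
  apply: cvg_near_cst; near=> n; rewrite /g indicE mem_set ?mul1r//=.
  have nbig : Num.max (normc (f x)) (normc (f x))^-1 <= n.+1%:R :> R.
    apply: (@le_trans _ _ n%:R); last by rewrite ler_nat.
    by near: n; exact: nbhs_infty_ger.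
  move: nbig; rewrite ge_max => /andP[un nu]; apply/andP; split => //.
  by rewrite -[leRHS]invrK lef_pV2 ?posrE ?invr_gt0.
under [X in _ --> X]eq_integral do rewrite -limg.
exact: cvg_monotone_convergence.
Unshelve. all: by end_near. Qed.

Lemma cvge_le_const (u : nat -> \bar R) (l c : \bar R) :
  u n @[n --> \oo] --> l -> (forall n, (u n <= c)%E) -> (l <= c)%E.
Proof.
move=> ul uc; rewrite -(cvg_lim _ ul)//; apply: lime_le; last exact: nearW.
by apply/cvg_ex; exists l.
Qed.

End truncation_limit.

Section L1L2_operations.
Context {R : realType} d (T : measurableType d) (mu : {measure set T -> \bar R}).
Implicit Types f g : T -> cplx R.

Lemma L1L2N f : L1L2 mu f -> L1L2 mu (fun x => - f x).
Proof.
move=> [/in_Lp1P[mf f1] /in_Lp2P[_ f2]].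
have nN x : normc (- f x) = normc (f x) by exact: normcN.
by split; [apply/in_Lp1P|apply/in_Lp2P]; (split; first exact: cmeasurableN);
  under eq_integral do rewrite nN.
Qed.

Lemma L1L2D f g : L1L2 mu f -> L1L2 mu g -> L1L2 mu (fun x => f x + g x).
Proof.
move=> [/in_Lp1P[mf f1] /in_Lp2P[_ f2]] [/in_Lp1P[mg g1] /in_Lp2P[_ g2]].
have mfg := cmeasurableD mf mg.
have [mnf mng] := (cmeasurable_normc mf, cmeasurable_normc mg).
have [nf0 ng0] := (fun x => normc_ge0 (f x), fun x => normc_ge0 (g x)).
split; [apply/in_Lp1P|apply/in_Lp2P]; split => //.
  apply: (@le_lt_trans _ _ (\int[mu]_x (normc (f x) + normc (g x))%:E)%E).
    apply: ge0_le_integral_EFin.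
    - exact: cmeasurable_normc.
    - exact: measurable_funD.
    - by move=> x; exact: normc_ge0.
    - by move=> x; exact: normcD_le.
  by rewrite ge0_integralD_EFin// lte_add_pinfty.
have msf : measurable_fun [set: T] (fun x => normc (f x) ^+ 2).
  exact: measurable_funX.
have msg : measurable_fun [set: T] (fun x => normc (g x) ^+ 2).
  exact: measurable_funX.
apply: (@le_lt_trans _ _
    (\int[mu]_x (2 * normc (f x) ^+ 2 + 2 * normc (g x) ^+ 2)%:E)%E).
  apply: ge0_le_integral_EFin.
  - exact/measurable_funX/cmeasurable_normc.
  - by apply: measurable_funD; exact: measurable_funM.
  - by move=> x; exact: sqr_ge0.
  - by move=> x; exact: sqr_normcD.
have sq0 (h : T -> cplx R) x : 0 <= normc (h x) ^+ 2 by exact: sqr_ge0.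
rewrite ge0_integralD_EFin; last 4 first.
- exact: measurable_funM.
- exact: measurable_funM.
- by move=> x; rewrite mulr_ge0.
- by move=> x; rewrite mulr_ge0.
by rewrite !ge0_integralZl_real// lte_add_pinfty// lte_mul_pinfty.
Qed.

Lemma L1L2_0 : L1L2 mu (fun=> 0).
Proof.
split; [apply/in_Lp1P|apply/in_Lp2P]; (split; first by split; exact: measurable_cst);
  by under eq_integral do rewrite normc0 ?expr0n//; rewrite integral0 ltry.
Qed.

End L1L2_operations.

Section duality.
Context {R : realType} d1 (X : measurableType d1) d2 (Y : measurableType d2).
Context (lam : {measure set X -> \bar R}) (pi : {measure set Y -> \bar R}).
Context (F : (X -> cplx R) -> Y -> cplx R) (FF : fourier_like lam pi F).

(** Test [u] against $k = u |u|^{q-2}$, for which $u \bar k = |u|^q$, cut off to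
a set where $1/m \le |u| \le m$ in order to be integrable. With [B] the
$L^{q'}$ norm of [k], the integral [I] of $u \bar k$ satisfies
$B = I^{1 - 1/q}$, and $I \le N B$ gives $I \le N^q$. As
$4 \int u \bar k = \|u + k\|^2 - \|u - k\|^2$, the integral of $u \bar k$ is
bounded by that of $|w| |F k|$, which is at most $N B$. *)
Lemma truncated_Lq_bound (q N m : R) (u : X -> cplx R) (w : Y -> cplx R) :
  2 <= q -> 0 < m -> in_Lp lam 2%:E u -> cmeasurable w ->
  (forall k, L1L2 lam k ->
    (\int[lam]_x (normc (u x + k x) ^+ 2)%:E =
     \int[pi]_y (normc (w y + F k y) ^+ 2)%:E)%E /\
    (\int[lam]_x (normc (u x - k x) ^+ 2)%:E =
     \int[pi]_y (normc (w y - F k y) ^+ 2)%:E)%E) ->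
  (forall k B, L1L2 lam k -> 0 < B ->
    (\int[lam]_x (normc (k x) `^ (q / (q - 1)))%:E <=
      (B `^ (q / (q - 1)))%:E)%E ->
    (\int[pi]_y (normc (w y) * normc (F k y))%:E <= (N * B)%:E)%E) ->
  (\int[lam]_x (\1_[set x | m^-1 <= normc (u x) <= m] x *
     normc (u x) `^ q)%:E <= (N `^ q)%:E)%E.
Proof.
move=> q2 m0 /in_Lp2P[mu u2] mw polar bound.
have q0 : 0 < q by rewrite (lt_le_trans _ q2).
have q10 : 0 < q - 1 by lra.
have mnu := cmeasurable_normc mu.
have uge0 x := normc_ge0 (u x).
pose D := [set x | m^-1 <= normc (u x) <= m].
have mD : measurable D by exact: measurable_normc_between.
rewrite -/D.
have DE x : \1_D x = (m^-1 <= normc (u x) <= m)%R%:R :> R.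
  by rewrite indicE; congr (nat_of_bool _)%:R; apply/idP/idP; rewrite inE.
have mDind : measurable_fun [set: X] (\1_D : X -> R) by exact: measurable_indic.
pose k x := (\1_D x * normc (u x) `^ (q - 2))%:C * u x.
have nk x : normc (k x) = \1_D x * normc (u x) `^ (q - 1).
  rewrite /k normcM normc_real ger0_norm ?mulr_ge0 ?powR_ge0// -mulrA.
  congr (_ * _); rewrite -{2}[normc (u x)]powRr1// -powRD.
    by congr (_ `^ _); ring.
  by rewrite (_ : _ == 0 = false)//; apply/negbTE; lra.
have mk : cmeasurable k.
  apply: cmeasurableM => //; apply: cmeasurable_real; apply: measurable_funM => //.
  exact: measurable_normc_powR.
have onD x : \1_D x = 0 :> R \/
    [/\ \1_D x = 1 :> R, m^-1 <= normc (u x) & normc (u x) <= m].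
  rewrite DE; case: (boolP (m^-1 <= normc (u x) <= m)) => [/andP[? ?]|_].
    by right.
  by left.
have u_gt0 x : m^-1 <= normc (u x) -> 0 < normc (u x).
  by apply: lt_le_trans; rewrite invr_gt0.
have powR_split x e : 0 < normc (u x) ->
    normc (u x) `^ e = normc (u x) `^ (e - 2) * normc (u x) ^+ 2.
  move=> ux0; rewrite -powR_mulrn// -powRD ?(gt_eqF ux0) ?implybT//.
  by rewrite subrK.
have pow_le x : normc (u x) <= m -> normc (u x) `^ (q - 2) <= m `^ (q - 2).
  by move=> um; rewrite ge0_ler_powR ?nnegrE ?(ltW m0)//; lra.
have k1 x : normc (k x) <= m * m `^ (q - 2) * normc (u x) ^+ 2.
  rewrite nk; have [->|[-> um mu']] := onD x.
    by rewrite mul0r !mulr_ge0 ?powR_ge0 ?(ltW m0).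
  have ux := u_gt0 _ um; rewrite mul1r powR_split// ler_wpM2r ?sqr_ge0//.
  rewrite (_ : q - 1 - 2 = q - 2 - 1); last by ring.
  rewrite powRB ?(gt_eqF ux) ?implybT// powRr1// mulrC.
  rewrite ler_pM ?powR_ge0 ?invr_ge0 ?pow_le//.
  by rewrite -[leRHS]invrK lef_pV2 ?posrE ?invr_gt0.
have kE x : normc (k x) ^+ 2 <= (m `^ (q - 2)) ^+ 2 * normc (u x) ^+ 2.
  rewrite -exprMn lerXn2r ?nnegrE ?mulr_ge0 ?powR_ge0 ?normc_ge0//.
  rewrite nk; have [->|[-> um mu']] := onD x.
    by rewrite mul0r mulr_ge0 ?powR_ge0.
  have ux := u_gt0 _ um; rewrite mul1r.
  rewrite (_ : q - 1 = q - 2 + 1); last by ring.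
  by rewrite powRD ?(gt_eqF ux) ?implybT// powRr1// ler_wpM2r// pow_le.
have u2_fin (c : R) : 0 <= c -> (\int[lam]_x (c * normc (u x) ^+ 2)%:E < +oo)%E.
  move=> c0; rewrite ge0_integralZl_real//; last 2 first.
  - exact: measurable_funX.
  - by move=> x; exact: sqr_ge0.
  by rewrite lte_mul_pinfty.
have mu2 (c : R) : measurable_fun [set: X] (fun x => c * normc (u x) ^+ 2).
  by apply: measurable_funM => //; exact: measurable_funX.
have Lk : L1L2 lam k.
  split; [apply/in_Lp1P|apply/in_Lp2P]; split => //.
    apply: (@le_lt_trans _ _ (\int[lam]_x (m * m `^ (q - 2) * normc (u x) ^+ 2)%:E)%E).
      apply: ge0_le_integral_EFin => //; first exact: cmeasurable_normc.
      by move=> x; exact: normc_ge0.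
    by apply: u2_fin; rewrite mulr_ge0 ?powR_ge0 ?ltW.
  apply: (@le_lt_trans _ _ (\int[lam]_x ((m `^ (q - 2)) ^+ 2 * normc (u x) ^+ 2)%:E)%E).
    apply: ge0_le_integral_EFin => //; first exact: cmeasurable_sqr_normc.
    by move=> x; exact: sqr_ge0.
  by apply: u2_fin; exact: sqr_ge0.
have mI : measurable_fun [set: X] (fun x => \1_D x * normc (u x) `^ q).
  by apply: measurable_funM => //; exact: measurable_normc_powR.
have I0 x : 0 <= \1_D x * normc (u x) `^ q by rewrite mulr_ge0 ?powR_ge0.
pose I := fine (\int[lam]_x (\1_D x * normc (u x) `^ q)%:E)%E.
have IE : (\int[lam]_x (\1_D x * normc (u x) `^ q)%:E = I%:E)%E.
  rewrite /I fineK// ge0_fin_numE ?integral_ge0_EFin//.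
  apply: (@le_lt_trans _ _ (\int[lam]_x (m `^ (q - 2) * normc (u x) ^+ 2)%:E)%E).
    apply: ge0_le_integral_EFin => // x.
    have [->|[-> um mu']] := onD x.
      by rewrite mul0r mulr_ge0 ?powR_ge0 ?sqr_ge0.
    have ux := u_gt0 _ um.
    by rewrite mul1r powR_split// ler_wpM2r ?sqr_ge0// pow_le.
  by apply: u2_fin; exact: powR_ge0.
rewrite IE lee_fin.
have : 0 <= I by rewrite -lee_fin -IE integral_ge0_EFin.
rewrite le_eqVlt => /predU1P[<-|Ip]; first exact: powR_ge0.
pose B := I `^ (1 - q^-1); have B0 : 0 < B by rewrite powR_gt0.
have BE : B `^ (q / (q - 1)) = I.
  rewrite /B -powRrM (_ : _ * _ = 1); first by rewrite powRr1// ltW.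
  by field; rewrite !gt_eqF.
have wk : (\int[pi]_y (normc (w y) * normc (F k y))%:E <= (N * B)%:E)%E.
  apply: bound => //; rewrite BE -IE le_eqVlt; apply/orP; left; apply/eqP.
  apply: eq_integral => x _; rewrite nk.
  have [->|[-> um mu']] := onD x.
    by rewrite !mul0r powR0// gt_eqF// divr_gt0.
  by rewrite !mul1r -powRrM mulrC divfK// gt_eqF.
have mFk := fl_measurable FF Lk.
have [plus minus] := polar _ Lk.
have mukm := cmeasurableB mu mk.
have uk : (\int[lam]_x (normc (u x + k x) ^+ 2)%:E =
    \int[lam]_x (normc (u x - k x) ^+ 2)%:E + (4 * I)%:E)%E.
  rewrite EFinM -IE -ge0_integralZl_real// -ge0_integralD_EFin//; last 4 first.
  - exact: (cmeasurable_sqr_normc mukm).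
  - exact: measurable_funM.
  - by move=> x; exact: sqr_ge0.
  - by move=> x; rewrite mulr_ge0.
  apply: eq_integral => x _; rewrite polarization; congr (_ + 4 * _)%:E.
  have -> : complex.Re (u x * (k x)^*) =
      \1_D x * normc (u x) `^ (q - 2) * normc (u x) ^+ 2.
    by rewrite sqr_normcE /k; case: (u x) => ? ? /=; ring.
  have [->|[-> um mu']] := onD x; first by rewrite !mul0r.
  by rewrite !mul1r [in RHS]powR_split// u_gt0.
have wFk : (\int[pi]_y (normc (w y + F k y) ^+ 2)%:E <=
    \int[pi]_y (normc (w y - F k y) ^+ 2)%:E + (4 * (N * B))%:E)%E.
  have mwF : measurable_fun [set: Y] (fun y => normc (w y) * normc (F k y)).
    by apply: measurable_funM; exact: cmeasurable_normc.
  have wF0 y : 0 <= normc (w y) * normc (F k y) by rewrite mulr_ge0 ?normc_ge0.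
  apply: (@le_trans _ _ (\int[pi]_y (normc (w y - F k y) ^+ 2)%:E +
      \int[pi]_y (4 * (normc (w y) * normc (F k y)))%:E)%E).
    rewrite -ge0_integralD_EFin//; last 4 first.
    - by apply: cmeasurable_sqr_normc; exact: cmeasurableB.
    - exact: measurable_funM.
    - by move=> y; exact: sqr_ge0.
    - by move=> y; rewrite mulr_ge0.
    apply: ge0_le_integral_EFin.
    - by apply: cmeasurable_sqr_normc; exact: cmeasurableD.
    - apply: measurable_funD; last exact: measurable_funM.
      by apply: cmeasurable_sqr_normc; exact: cmeasurableB.
    - by move=> y; exact: sqr_ge0.
    move=> y; rewrite polarization lerD2l ler_pM2l//.
    apply: le_trans (ler_norm _) _; apply: le_trans (ler_Re_normc _) _.
    by rewrite normcM normc_conj.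
  by apply: leeD => //; rewrite ge0_integralZl_real// EFinM lee_wpmul2l.
have Kfin : (\int[lam]_x (normc (u x - k x) ^+ 2)%:E)%E \is a fin_num.
  rewrite ge0_fin_numE; last by apply: integral_ge0_EFin => x; exact: sqr_ge0.
  apply: (@le_lt_trans _ _
    (\int[lam]_x ((2 + 2 * (m `^ (q - 2)) ^+ 2) * normc (u x) ^+ 2)%:E)%E).
    apply: ge0_le_integral_EFin => //.
    - exact: cmeasurable_sqr_normc.
    - by move=> x; exact: sqr_ge0.
    move=> x; apply: le_trans (sqr_normcD _ _) _.
    by rewrite normcN [leRHS]mulrDl lerD2l -mulrA ler_pM2l.
  by apply: u2_fin; rewrite addr_ge0// mulr_ge0// sqr_ge0.
have : 4 * I <= 4 * (N * B).
  rewrite -lee_fin -(leeD2lE _ _ Kfin) -uk plus.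
  by apply: le_trans wFk _; rewrite minus.
rewrite ler_pM2l// => INB.
have NI : I `^ q^-1 <= N.
  have := INB; rewrite -{1}(powRr1 (ltW Ip)) (_ : 1 = q^-1 + (1 - q^-1)); last by ring.
  by rewrite powRD ?(gt_eqF Ip) ?implybT// ler_pM2r.
rewrite -(powRr1 (ltW Ip)) -(mulVf (lt0r_neq0 q0)) powRrM.
by rewrite ge0_ler_powR ?nnegrE ?powR_ge0 ?(ltW q0)// (le_trans _ NI)// powR_ge0.
Qed.

Lemma Lq_bound (q N : R) (u : X -> cplx R) (w : Y -> cplx R) :
  2 <= q -> in_Lp lam 2%:E u -> cmeasurable w ->
  (forall k, L1L2 lam k ->
    (\int[lam]_x (normc (u x + k x) ^+ 2)%:E =
     \int[pi]_y (normc (w y + F k y) ^+ 2)%:E)%E /\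
    (\int[lam]_x (normc (u x - k x) ^+ 2)%:E =
     \int[pi]_y (normc (w y - F k y) ^+ 2)%:E)%E) ->
  (forall k B, L1L2 lam k -> 0 < B ->
    (\int[lam]_x (normc (k x) `^ (q / (q - 1)))%:E <=
      (B `^ (q / (q - 1)))%:E)%E ->
    (\int[pi]_y (normc (w y) * normc (F k y))%:E <= (N * B)%:E)%E) ->
  (\int[lam]_x (normc (u x) `^ q)%:E <= (N `^ q)%:E)%E.
Proof.
move=> q2 u2 mw polar bound.
have qn0 : q != 0 by rewrite gt_eqF// (lt_le_trans _ q2).
have [mu _] := (in_Lp2P lam u).1 u2.
apply: (cvge_le_const (truncation_cvg mu qn0)) => n.
by apply: (truncated_Lq_bound q2 _ u2 mw polar bound).
Qed.

Lemma flN k : L1L2 lam k -> F (fun x => - k x) = (fun y => - F k y).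
Proof.
move=> Lk.
have LN := L1L2N Lk; have L0 := L1L2_0 lam.
have F0 : F (fun=> 0) = (fun=> 0).
  have := flD FF L0 L0; rewrite (_ : (fun x : X => 0 + 0) = (fun=> 0)); last first.
    by apply/funext => x; rewrite addr0.
  move=> F00; apply/funext => y; have := congr1 (fun f => f y) F00.
  by move=> /eqP; rewrite -subr_eq subrr => /eqP.
apply/funext => y; apply/eqP; rewrite -subr_eq0 opprK addrC.
have := flD FF Lk LN; rewrite (_ : (fun x => k x - k x) = (fun=> 0)).
  by rewrite F0 => /(congr1 (fun f => f y)) <-.
by apply/funext => x; rewrite subrr.
Qed.

End duality.

Section L2_limits.
Context {R : realType} d1 (X : measurableType d1) d2 (Y : measurableType d2).
Context (lam : {measure set X -> \bar R}) (pi : {measure set Y -> \bar R}).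

Lemma cLnorm2_opp d (T : measurableType d) (mu : {measure set T -> \bar R})
  (f g : T -> cplx R) :
  cLnorm mu 2%:E (fun x => f x - g x) = cLnorm mu 2%:E (fun x => g x - f x).
Proof.
rewrite !cLnorm2E; congr (_ `^ _)%E; apply: eq_integral => x _.
by rewrite -(normcN (g x - f x)) opprB.
Qed.

(** Comparison of norms in two different $L^2$ spaces passes to limits by the
triangle inequality in each of them; exchanging the spaces gives equality. *)
Lemma cLnorm2_limit_le (u k : X -> cplx R) (w l : Y -> cplx R)
    (f_ : nat -> X -> cplx R) (g_ : nat -> Y -> cplx R) :
  cmeasurable u -> cmeasurable k -> (forall n, cmeasurable (f_ n)) ->
  cmeasurable w -> cmeasurable l -> (forall n, cmeasurable (g_ n)) ->
  cLnorm lam 2%:E (f_ n \- u) @[n --> \oo] --> 0%E ->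
  cLnorm pi 2%:E (g_ n \- w) @[n --> \oo] --> 0%E ->
  (forall n, cLnorm lam 2%:E (fun x => f_ n x + k x) =
             cLnorm pi 2%:E (fun y => g_ n y + l y)) ->
  (cLnorm lam 2%:E (fun x => u x + k x)%R <=
   cLnorm pi 2%:E (fun y => w y + l y)%R)%E.
Proof.
move=> mu mk mf mw ml mg fu gw fg.
set x := cLnorm lam _ _; set y := cLnorm pi _ _.
pose a n := cLnorm lam 2%:E (f_ n \- u).
pose b n := cLnorm pi 2%:E (g_ n \- w).
have xy n : (x <= a n + b n + y)%E.
  pose c := cLnorm lam 2%:E (fun x => f_ n x + k x).
  rewrite -addeA; apply: (@le_trans _ _ (a n + c)%E).
    rewrite /a cLnorm2_opp /x.
    rewrite (_ : (fun x => u x + k x) = (fun x => (u x - f_ n x) + (f_ n x + k x))).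
      by apply: cLnorm2_triangle; [exact: cmeasurableB|exact: cmeasurableD].
    by apply/funext => z; rewrite addrA subrK.
  rewrite /c fg leeD2l// /y.
  rewrite (_ : (fun y => g_ n y + l y) = (fun y => (g_ n y - w y) + (w y + l y))).
    by apply: cLnorm2_triangle; [exact: cmeasurableB|exact: cmeasurableD].
  by apply/funext => z; rewrite addrA subrK.
apply/lee_addgt0Pr => e e0.
have e2 : (0 < (e / 2)%:E)%E by rewrite lte_fin divr_gt0.
have small (v : nat -> \bar R) : v n @[n --> \oo] --> 0%E ->
    \forall n \near \oo, (v n <= (e / 2)%:E)%E.
  move=> /fine_cvgP[vfin /cvgrPdist_lt/(_ (e / 2))].
  rewrite divr_gt0// => /(_ isT) v0; near=> n.
  have vn : v n \is a fin_num by near: n.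
  rewrite -(fineK vn) lee_fin (le_trans (ler_norm _))// -normrN -sub0r ltW//.
  by near: n.
near \oo => n.
apply: le_trans (xy n) _; rewrite addeC leeD2l//.
rewrite [e]splitr EFinD leeD//; near: n; exact: small.
Unshelve. all: by end_near. Qed.

End L2_limits.

(** * Characters are bounded by one *)

Section borel_measurability.
Context {R : realType}.

Lemma normr_normc (z : cplx R) : `|z| = (normc z)%:C.
Proof. by case: z => a b; rewrite normc_def. Qed.

Lemma continuous_contraction (g : cplx R -> R) :
  (forall z w, `|g z - g w| <= normc (z - w)) -> continuous g.
Proof.
move=> g1 z; have FF : Filter (nbhs (z : cplx R)) by exact: nbhs_filter.
apply: (proj2 (@cvgrPdist_lt R R^o _ (nbhs (z : cplx R)) FF g (g z))) => e e0.
have e0C : 0 < e%:C :> R[i] by rewrite ltcR.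
have B : nbhs (z : cplx R) (ball (z : cplx R) e%:C) by exact: nbhsx_ballx.
apply: filterS B => w; rewrite -ball_normE /= normr_normc ltcR.
by apply: le_lt_trans; exact: g1.
Qed.

Lemma continuous_Re : continuous (@complex.Re R : cplx R -> R).
Proof.
apply: continuous_contraction => z w; apply: le_trans (ler_Re_normc _).
by case: z w => ? ? [].
Qed.

Lemma continuous_Im : continuous (@complex.Im R : cplx R -> R).
Proof.
apply: continuous_contraction => z w; apply: le_trans (ler_Im_normc _).
by case: z w => ? ? [].
Qed.

Lemma continuous_normc : continuous (@normc R : cplx R -> R).
Proof.
apply: continuous_contraction => z w.
have E (a b : cplx R) : normc a <= normc (a - b) + normc b.
  by rewrite -{1}(subrK b a) normcD_le.
have := E w z; have := E z w; have : normc (w - z) = normc (z - w).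
  by rewrite -(normcN (z - w)) opprB.
by rewrite ler_norml; lra.
Qed.

Lemma continuous_borel_measurable (T : ptopologicalType) (g : T -> R) :
  continuous g -> measurable_fun [set: borel T] (g : borel T -> R).
Proof.
move=> /continuousP cg; apply: (measurability _ (RGenOpens.measurableE R)).
move=> _ [_ [a [b ->] <-]]; rewrite setTI; apply: sub_sigma_algebra.
exact/cg/interval_open.
Qed.

Lemma continuous_cmeasurable (T : ptopologicalType) (f : T -> cplx R) :
  continuous f -> cmeasurable (f : borel T -> cplx R).
Proof.
move=> cf; split; apply: continuous_borel_measurable => x;
  apply: (continuous_comp (cf x)); [exact: continuous_Re|exact: continuous_Im].
Qed.

End borel_measurability.

Section characters_bound.
Context {R : realType} {H : ptopologicalType} (K : hypergroup R H).

(** The integrals against [m] are those against a measure in the sense of the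
integration theory, so that its inequalities apply to them. *)
Lemma prob_measureP (m : set H -> cplx R) : prob_measure m ->
  exists2 mu : {measure set (borel H) -> \bar R},
    real_measure m = mu & mu [set: H] = 1%E.
Proof.
move=> [[[mB msum _] mge0] m1].
have m0 : m set0 = 0.
  have := msum (fun=> set0) (fun=> @measurable0 _ (borel H))
    (@trivIset_set0 _ _ _).
  rewrite bigcup0// => u0.
  have shifted : (fun n => \sum_(i < n.+1) m set0) @ \oo --> m set0.
    by rewrite (@cvg_shiftS _ (fun n => \sum_(i < n) m set0)).
  have := cvgD u0 (cvg_cst (m set0)).
  rewrite (_ : _ + _ = fun n => \sum_(i < n.+1) m set0); last first.
    by apply/funext => n; rewrite big_ord_recr.
  move=> u1; have /(_ (@norm_hausdorff _ _) _ _ _)/eqP :=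
    cvg_unique _ (u1 _ _) shifted.
  by rewrite -subr_eq0 addrK => /eqP.
have mu0 : real_measure m set0 = 0%E by rewrite /real_measure m0.
have muge0 A : (0 <= real_measure m A)%E.
  by rewrite lee_fin; have := mge0 A; rewrite lecE => /andP[].
have musum : semi_sigma_additive (real_measure m).
  move=> F mF tF mUF; under eq_fun do rewrite sumEFin big_mkord -raddf_sum.
  exact: cvg_comp (cvg_Re (msum F mF tF)) _.
pose mu : {measure set (borel H) -> \bar R} :=
  HB.pack (real_measure m)
    (isMeasure.Build _ _ _ (real_measure m) mu0 muge0 musum).
by exists mu => //=; rewrite /real_measure m1.
Qed.

Lemma prob_measure_integral_le (m : set H -> cplx R) (f : H -> cplx R) (M : R) :
  prob_measure m -> continuous f -> (forall x, normc (f x) <= M) ->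
  normc (mintegral m f) <= M.
Proof.
move=> /prob_measureP[mu muE muT] cf fM; rewrite /mintegral muE.
have mf := continuous_cmeasurable cf.
have M0 : 0 <= M by apply: le_trans (fM point); exact: normc_ge0.
have leM : (\int[mu]_x (normc (f x))%:E <= M%:E)%E.
  apply: (@le_trans _ _ (\int[mu]_x (cst M x)%:E)%E).
    apply: ge0_le_integral_EFin => //; first exact: cmeasurable_normc.
    by move=> x; exact: normc_ge0.
  rewrite (@integral_cst _ (borel H) R mu [set: H] measurableT M%:E).
  by rewrite [X in (_ * X)%E]muT mule1.
rewrite -lee_fin; apply: le_trans (leM); apply: (@normc_cintegral_le _ _ _ mu).
by apply/in_Lp1P; split => //; apply: le_lt_trans leM _; rewrite ltry.
Qed.

(** If $M = \sup |\chi|$, then $|\chi(x)|^2 = |\chi(x * x)| \le M$ for all [x],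
so that $M^2 \le M$. *)
Lemma character_le1 (chi : dual K) x : normc (char_fun chi x) <= 1.
Proof.
have [[cchi [M chiM]] _ _ chiE] := set_valP chi.
have ubM : ubound [set normc (char_fun chi y) | y in setT] M.
  by move=> _ [y _ <-]; exact: chiM.
have hs : has_sup [set normc (char_fun chi y) | y in setT].
  by split; [exists (normc (char_fun chi x)), x|exists M].
set S := sup [set normc (char_fun chi y) | y in setT].
have leS y : normc (char_fun chi y) <= S by apply: sup_upper_bound => //; exists y.
have S0 : 0 <= S by apply: le_trans (leS x); exact: normc_ge0.
have sq y : normc (char_fun chi y) ^+ 2 <= S.
  rewrite expr2 -normcM -chiE; apply: prob_measure_integral_le leS => //.
  exact: hconv_dirac_prob.
suff S1 : S <= 1 by exact: le_trans (leS x) S1.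
rewrite leNgt; apply/negP => S1.
have Sp : 0 < S by exact: lt_trans S1.
have : S <= Num.sqrt S.
  apply: ge_sup; first by exists (normc (char_fun chi x)), x.
  move=> _ [y _ <-]; rewrite -(ger0_norm (normc_ge0 _)) -sqrtr_sqr.
  exact: ler_wsqrtr.
rewrite -{1}(sqr_sqrtr S0) expr2 ger_pMr ?sqrtr_gt0// leNgt -sqrtr1 ltr_sqrt//.
by rewrite S1.
Qed.

End characters_bound.

(** * The Fourier transform on a hypergroup *)

Section fourier_transform.
Context {R : realType} {H : ptopologicalType} (K : hypergroup R H).
Context (lam : {measure set (borel H) -> \bar R}).
Implicit Types (f g : H -> cplx R) (chi psi : dual K).

Lemma char_continuous chi : continuous (char_fun chi).
Proof. by have [[cchi _] _ _ _] := set_valP chi. Qed.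

Lemma compact_Borel (F : set H) : compact F -> @measurable _ (borel H) F.
Proof.
move=> /(compact_closed (hypergroup_hausdorff K)) cF.
rewrite -(setCK F); apply: measurableC; apply: sub_sigma_algebra.
exact: closed_openC.
Qed.

Lemma in_Lp1_mul_bounded f (m : H -> cplx R) (M : R) :
  @in_Lp _ _ (borel H) lam 1%:E f -> @cmeasurable _ _ (borel H) m ->
  (forall x, normc (m x) <= M) ->
  @in_Lp _ _ (borel H) lam 1%:E (fun x => f x * m x).
Proof.
move=> /in_Lp1P[mf f1] mm mM.
have M0 : 0 <= M by apply: le_trans (mM point); exact: normc_ge0.
have mfm := cmeasurableM mf mm.
apply/in_Lp1P; split => //.
apply: (@le_lt_trans _ _ (\int[lam]_x (M * normc (f x))%:E)%E).
  apply: ge0_le_integral_EFin.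
  - exact: cmeasurable_normc.
  - by apply: measurable_funM => //; exact: cmeasurable_normc.
  - by move=> x; exact: normc_ge0.
  - by move=> x; rewrite normcM mulrC ler_wpM2r// normc_ge0.
rewrite ge0_integralZl_real ?lte_mul_pinfty//.
- exact: cmeasurable_normc.
- by move=> x; exact: normc_ge0.
Qed.

Lemma cmeasurable_char chi : @cmeasurable _ _ (borel H) (char_fun chi).
Proof. exact/continuous_cmeasurable/char_continuous. Qed.

Lemma in_Lp1_mul_char f chi : @in_Lp _ _ (borel H) lam 1%:E f ->
  @in_Lp _ _ (borel H) lam 1%:E (fun x => f x * (char_fun chi x)^*).
Proof.
move=> f1; apply: (in_Lp1_mul_bounded (M := 1) f1).
  exact/cmeasurable_conj/cmeasurable_char.
by move=> x; rewrite normc_conj; exact: character_le1.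
Qed.

Lemma fourierD f g : @in_Lp _ _ (borel H) lam 1%:E f ->
  @in_Lp _ _ (borel H) lam 1%:E g ->
  fourier lam (fun x => f x + g x) = (fun chi => fourier lam f chi + fourier lam g chi).
Proof.
move=> f1 g1; apply/funext => chi; rewrite /fourier.
under eq_fun do rewrite mulrDl.
by apply: cintegralD; exact: in_Lp1_mul_char.
Qed.

Lemma normc_fourier_le f chi : @in_Lp _ _ (borel H) lam 1%:E f ->
  ((normc (fourier lam f chi))%:E <= \int[lam]_x (normc (f x))%:E)%E.
Proof.
move=> f1; have fchi := in_Lp1_mul_char chi f1.
apply: le_trans (normc_cintegral_le fchi) _.
apply: ge0_le_integral_EFin.
- by apply: cmeasurable_normc; have [] := (in_Lp1P _ _).1 fchi.
- by apply: cmeasurable_normc; have [] := (in_Lp1P _ _).1 f1.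
- by move=> x; exact: normc_ge0.
move=> x; rewrite normcM normc_conj ler_piMr ?normc_ge0//.
exact: character_le1.
Qed.

Lemma normc_fourierB_le f chi psi : @in_Lp _ _ (borel H) lam 1%:E f ->
  ((normc (fourier lam f chi - fourier lam f psi))%:E <=
   \int[lam]_x (normc (f x) * normc (char_fun chi x - char_fun psi x))%:E)%E.
Proof.
move=> f1; pose m x : cplx R := (char_fun chi x)^* - (char_fun psi x)^*.
have nm x : normc (m x) = normc (char_fun chi x - char_fun psi x).
  by rewrite -normc_conj /m; congr normc; rewrite rmorphB/= !conjcK.
have fm : @in_Lp _ _ (borel H) lam 1%:E (fun x => f x * m x).
  apply: (in_Lp1_mul_bounded (M := 1 + 1) f1).
    by apply: cmeasurableB; exact/cmeasurable_conj/cmeasurable_char.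
  move=> x; apply: le_trans (normcD_le _ _) _.
  by rewrite normcN !normc_conj lerD// character_le1.
have -> : fourier lam f chi - fourier lam f psi = cintegral lam (fun x => f x * m x).
  apply/eqP; rewrite subr_eq -cintegralD//; last exact: in_Lp1_mul_char.
  by apply/eqP; congr cintegral; apply/funext => x; rewrite /m mulrBr subrK.
apply: le_trans (normc_cintegral_le fm) _.
by under eq_integral do rewrite normcM nm.
Qed.

(** Radon measures are tight on an integrable function: up to [e] it lives
where $1/m \le |f| \le m$, a set of finite measure, hence contained in an
open set of finite measure; a compact set fills the latter up to measure
$e / 2m$, on which a function bounded by $m$ has integral at most $e / 2$. *)
Lemma integrable_tight f (e : R) : radon lam ->
  @in_Lp _ _ (borel H) lam 1%:E f -> 0 < e ->
  exists2 F : set H, compact F &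
    (\int[lam]_x (\1_(~` F) x * normc (f x))%:E <= e%:E)%E.
Proof.
move=> [_ outer inner] f1 e0; have [mf ffin] := (in_Lp1P _ _).1 f1.
have mnf := cmeasurable_normc mf.
pose I := fine (\int[lam]_x (normc (f x))%:E)%E.
have IE : (\int[lam]_x (normc (f x))%:E = I%:E)%E.
  rewrite /I fineK// ge0_fin_numE//.
  by apply: integral_ge0_EFin => x; exact: normc_ge0.
pose D (n : nat) := [set x | n.+1%:R^-1 <= normc (f x) <= n.+1%:R].
have mD n : @measurable _ (borel H) (D n) by exact: measurable_normc_between.
have mDf (A : set H) : @measurable _ (borel H) A ->
    measurable_fun [set: borel H] (fun x => \1_A x * normc (f x)).
  by move=> mA; apply: measurable_funM => //; exact: measurable_indic.
have Df0 (A : set H) x : 0 <= \1_A x * normc (f x).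
  by rewrite mulr_ge0 ?normc_ge0.
have splitD (A : set H) : @measurable _ (borel H) A ->
    (\int[lam]_x (normc (f x))%:E = \int[lam]_x (\1_A x * normc (f x))%:E +
       \int[lam]_x (\1_(~` A) x * normc (f x))%:E)%E.
  move=> mA; rewrite -ge0_integralD_EFin//; last 2 first.
  - exact: mDf.
  - exact: mDf (measurableC mA).
  apply: eq_integral => x _; congr EFin; rewrite !indicE in_setC.
  by case: (x \in A); rewrite /= !(mul0r, mul1r, addr0, add0r).
have [n Dn] : exists n,
    (\int[lam]_x (\1_(~` D n) x * normc (f x))%:E <= (e / 2)%:E)%E.
  apply: contrapT => /forallNP noD.
  suff : (\int[lam]_x (normc (f x) `^ 1)%:E <= (I - e / 2)%:E)%E.
    under eq_integral do rewrite powRr1 ?normc_ge0//.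
    by rewrite IE lee_fin; lra.
  apply: (cvge_le_const (truncation_cvg mf (oner_neq0 R))) => n.
  under eq_integral do rewrite powRr1 ?normc_ge0//.
  have /negP := noD n; rewrite -ltNge => Dn.
  rewrite EFinB leeBrDr// -IE (splitD _ (mD n)) leeD2l//; exact: ltW.
pose N : R := n.+1%:R; have N0 : 0 < N by rewrite /N ltr0n.
have lamD : (lam (D n) < +oo)%E.
  apply: (@le_lt_trans _ _ (\int[lam]_x (N * normc (f x))%:E)%E).
    have <- : (\int[lam]_x (\1_(D n) x)%:E = lam (D n))%E.
      by rewrite integral_indic// setIT.
    apply: ge0_le_integral_EFin => //.
    exact: measurable_funM.
    move=> x; rewrite indicE; case: (boolP (x \in D n)) => [|_]; last first.
      by rewrite mulr_ge0 ?normc_ge0// ltW.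
    move=> /set_mem /= /andP[Nx _].
    by rewrite mulrC -ler_pdivrMr// mul1r.
  by rewrite ge0_integralZl_real ?IE ?ltry// ?(ltW N0)// => x; exact: normc_ge0.
have [U [oU DU Ufin]] : exists U, [/\ open U, D n `<=` U & (lam U < +oo)%E].
  have := lamD; rewrite (outer _ (mD n)) => /ereal_inf_lt[_ [U [oU DU] <-] ?].
  by exists U.
have mU : @measurable _ (borel H) U by exact: sub_sigma_algebra.
pose del := e / 2 / N; have del0 : 0 < del by rewrite !divr_gt0.
have Ufn : lam U \is a fin_num by rewrite ge0_fin_numE.
have [F [cF FU FUdel]] : exists F, [/\ compact F, F `<=` U &
    (lam U - del%:E < lam F)%E].
  have : (lam U - del%:E < lam U)%E by rewrite lteBlDr// lteDl.
  rewrite {2}(inner _ oU) => /ereal_sup_gt[_ [F [cF FU] <-] ?].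
  by exists F.
have mF := compact_Borel cF; exists F => //.
have mUF : @measurable _ (borel H) (U `\` F) by exact: measurableD.
have lamUF : (lam (U `\` F) <= del%:E)%E.
  have Ffn : lam F \is a fin_num.
    rewrite ge0_fin_numE//; apply: le_lt_trans Ufin.
    by apply: le_measure; rewrite ?inE.
  have UE : lam U = (lam (U `\` F) + lam F)%E.
    by rewrite (measureDI lam mU mF) setIidr.
  move: FUdel; rewrite lteBlDr// UE addeC lteD2lE//; exact: ltW.
apply: (@le_trans _ _ (\int[lam]_x
    (\1_(~` D n) x * normc (f x) + N * \1_(U `\` F) x)%:E)%E).
  apply: ge0_le_integral_EFin => //.
  - exact: mDf (measurableC (mF)).
  - apply: measurable_funD; first exact: mDf (measurableC (mD n)).
    by apply: measurable_funM => //; exact: measurable_indic.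
  move=> x; rewrite !indicE !in_setC.
  have [xF|xF] := boolP (x \in F).
    by rewrite /= mul0r addr_ge0 ?mulr_ge0 ?normc_ge0// ltW.
  have [xD|xD] := boolP (x \in D n); last first.
    by rewrite /= lerDl mulr_ge0// ltW.
  rewrite [x \in U `\` F]mem_set.
    by move/set_mem: xD => /andP[_ fN]; rewrite /= mul1r mul0r add0r mulr1.
  split; first exact/DU/set_mem.
  by move/mem_set => xF'; rewrite xF' in xF.
rewrite ge0_integralD_EFin//; last 3 first.
- exact: mDf (measurableC (mD n)).
- by apply: measurable_funM => //; exact: measurable_indic.
- by move=> x; rewrite mulr_ge0// ltW.
rewrite ge0_integralZl_real ?(ltW N0)//.
rewrite integral_indic// setIT [e]splitr EFinD; apply: leeD => //.
apply: (@le_trans _ _ (N%:E * del%:E)%E).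
  by rewrite lee_wpmul2l// lee_fin ltW.
by rewrite -EFinM lee_fin /del mulrC divfK// gt_eqF.
Qed.

End fourier_transform.

Section fourier_continuity.
Context {R : realType} {H : ptopologicalType} (K : hypergroup R H).

(** Characters are continuous, and among continuous functions compact-open
convergence is uniform convergence on compact sets. *)
Lemma near_char (chi : dual K) (F : set H) (e : R) : compact F -> 0 < e ->
  \forall psi \near chi,
    forall x, F x -> normc (char_fun chi x - char_fun psi x) < e.
Proof.
move=> cF e0.
have cval : continuous (fun psi : dual K =>
    char_fun psi : {compact-open, H -> cplx R}).
  exact: (@initial_continuous (dual K) {compact-open, H -> cplx R} set_val).
have := cval chi.
have FF : Filter (nbhs chi) by exact: nbhs_filter.
have FFc : Filter ((fun psi : dual K => char_fun psi) @ chi) by exact: fmap_filter.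
move=> /(proj1 (compact_open_fam_compactP (@char_continuous _ _ _ chi) FFc)).
move=> /fam_cvgP /(_ _ cF) cv.
have e0C : 0 < e%:C :> R[i] by rewrite ltcR.
pose B := [set g : H -> cplx R |
  forall x, F x -> ball (char_fun chi x : cplx R) e%:C (g x)].
have : \forall psi \near chi, B (char_fun psi).
  apply: cv; apply/uniform_nbhs.
  exists [set zw : cplx R * cplx R | ball zw.1 e%:C zw.2]; split => //.
  exact: entourage_ball (PosNum e0C).
apply: (@filterS _ (nbhs chi) FF) => psi Bpsi x Fx.
by have := Bpsi x Fx; rewrite -ball_normE /= normr_normc ltcR.
Qed.

Context (lam : {measure set (borel H) -> \bar R}).

(** On a compact set that carries [f] up to [e / 4], nearby characters differ
by at most [del]; elsewhere their difference is at most two. *)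
Lemma fourier_continuous f : radon lam ->
  @in_Lp _ _ (borel H) lam 1%:E f ->
  continuous (fourier lam f : dual K -> cplx R).
Proof.
move=> rad f1 chi; have [mf ffin] := (in_Lp1P _ _).1 f1.
have mnf := cmeasurable_normc mf.
pose I := fine (\int[lam]_x (normc (f x))%:E)%E.
have I0 : 0 <= I by apply: fine_ge0; apply: integral_ge0_EFin => x; exact: normc_ge0.
have IE : (\int[lam]_x (normc (f x))%:E = I%:E)%E.
  rewrite /I fineK// ge0_fin_numE//.
  by apply: integral_ge0_EFin => x; exact: normc_ge0.
have FF : Filter (nbhs chi) by exact: nbhs_filter.
apply: (proj2 (@cvgrPdist_lt R[i] (cplx R) _ (nbhs chi) FF
  (fourier lam f) (fourier lam f chi))) => eC; rewrite ltcE => /andP[/= /eqP Im0 e0].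
pose e := complex.Re eC.
have eCE : eC = e%:C by apply/eqP; rewrite eq_complex /= Im0 !eqxx.
have e40 : 0 < e / 4 by rewrite divr_gt0.
have [F cF tight] := integrable_tight K rad f1 e40.
pose del := e / 4 / (I + 1).
have del0 : 0 < del by rewrite divr_gt0// ltr_wpDl.
have := near_char chi cF del0; apply: (@filterS _ (nbhs chi) FF) => psi close.
rewrite normr_normc eCE ltcR -lte_fin.
apply: le_lt_trans (normc_fourierB_le chi psi f1) _.
have mF := compact_Borel K cF.
have mFc : measurable_fun [set: borel H] (fun x => \1_(~` F) x * normc (f x)).
  by apply: measurable_funM => //; exact: measurable_indic (measurableC mF).
apply: (@le_lt_trans _ _ (\int[lam]_x
    (del * normc (f x) + 2 * (\1_(~` F) x * normc (f x)))%:E)%E).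
  apply: ge0_le_integral_EFin.
  - apply: measurable_funM => //; apply: cmeasurable_normc.
    by apply: cmeasurableB; exact: cmeasurable_char.
  - by apply: measurable_funD; exact: measurable_funM.
  - by move=> x; rewrite mulr_ge0 ?normc_ge0.
  move=> x; rewrite indicE in_setC; have [xF|xF] := boolP (x \in F).
    rewrite /= mul0r mulr0 addr0 mulrC ler_wpM2r ?normc_ge0// ltW// close//.
    exact: set_mem.
  rewrite /= mul1r; apply: ler_wpDl; first by rewrite mulr_ge0 ?normc_ge0 ?ltW.
  rewrite mulrC ler_wpM2r ?normc_ge0//; apply: le_trans (normcD_le _ _) _.
  by rewrite normcN (_ : 2 = 1 + 1)// lerD// character_le1.
rewrite ge0_integralD_EFin; last 4 first.
- exact: measurable_funM.
- exact: measurable_funM.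
- by move=> x; rewrite mulr_ge0 ?normc_ge0// ltW.
- by move=> x; rewrite !mulr_ge0 ?normc_ge0.
rewrite !ge0_integralZl_real ?(ltW del0)//; last 2 first.
- by move=> x; rewrite mulr_ge0 ?normc_ge0.
- by move=> x; exact: normc_ge0.
apply: (@le_lt_trans _ _ ((del * I)%:E + (2 * (e / 4))%:E)%E).
  by apply: leeD; rewrite EFinM ?IE// lee_wpmul2l.
rewrite -EFinD lte_fin.
have : del * I <= e / 4.
  by rewrite /del mulrAC ler_pdivrMr ?ltr_wpDl// ler_wpM2l ?(ltW e40)// lerDl.
by rewrite -/e in e0; lra.
Qed.

Lemma fourier_fourier_like (pi : {measure set (borel (dual K)) -> \bar R}) :
  radon lam -> plancherel_measure lam pi ->
  @fourier_like R _ (borel H) _ (borel (dual K)) lam pi (fourier lam).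
Proof.
move=> rad planch; split.
- by move=> f [f1 _]; apply: continuous_cmeasurable; exact: fourier_continuous.
- by move=> f g [f1 _] [g1 _]; exact: fourierD.
- by move=> f chi [f1 _]; exact: normc_fourier_le.
- by move=> f [f1 f2]; exact: planch.
Qed.

End fourier_continuity.

(** * The extended Plancherel transform *)

Section plancherel.
Context {R : realType} {H : ptopologicalType} (K : hypergroup R H).
Context (lam : {measure set (borel H) -> \bar R}).
Context (pi : {measure set (borel (dual K)) -> \bar R}).
Context (rad : radon lam) (planch : plancherel_measure lam pi).

Let FL := fourier_fourier_like rad planch.

Lemma integral_sqr_cLnorm2 d (T : measurableType d) (mu : {measure set T -> \bar R})
    (f : T -> cplx R) :
  (\int[mu]_x (normc (f x) ^+ 2)%:E = cLnorm mu 2%:E f `^ 2)%E.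
Proof.
rewrite cLnorm2E -poweRrM mulVf// poweRe1//.
by apply: integral_ge0_EFin => x; exact: sqr_ge0.
Qed.

Lemma cLnorm2_subrr d (T : measurableType d) (mu : {measure set T -> \bar R})
  (f : T -> cplx R) : cLnorm mu 2%:E (f \- f) = 0%E.
Proof.
rewrite cLnorm2E (_ : (fun x => _) = cst 0%E).
  by rewrite integral0 poweR0r// invr_neq0.
by apply/funext => x; rewrite /= subrr [normc _]normc0 expr0n.
Qed.

(** Plancherel's identity holds for [f_ n + k] along the sequence [f_] that
defines the extended transform of [u], and passes to the limit. *)
Lemma plancherel_transform_isometry (u : H -> cplx R) (w : dual K -> cplx R)
    (k : H -> cplx R) :
  plancherel_transform lam pi u w -> @L1L2 R _ (borel H) lam k ->
  (\int[lam]_x (normc (u x + k x) ^+ 2)%:E =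
   \int[pi]_chi (normc (w chi + fourier lam k chi) ^+ 2)%:E)%E.
Proof.
move=> [/in_Lp2P[mu _] /in_Lp2P[mw _] [f_ [fL fu fw]]] Lk.
have mk : @cmeasurable _ _ (borel H) k by case: Lk => /in_Lp1P[].
have mf n : @cmeasurable _ _ (borel H) (f_ n) by case: (fL n) => /in_Lp1P[].
have mFk := fl_measurable FL Lk.
have mFf n := fl_measurable FL (fL n).
have fk n : cLnorm lam 2%:E (fun x => f_ n x + k x) =
    cLnorm pi 2%:E (fun chi => fourier lam (f_ n) chi + fourier lam k chi).
  have Lfk : @L1L2 R _ (borel H) lam (fun x => f_ n x + k x) by exact: L1L2D.
  by rewrite !cLnorm2E (fl_L2 FL Lfk) (flD FL (fL n) Lk).
rewrite !integral_sqr_cLnorm2; congr (_ `^ _)%E; apply/eqP.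
rewrite eq_le; apply/andP; split.
  exact: (cLnorm2_limit_le mu mk mf mw mFk mFf fu fw fk).
by apply: (cLnorm2_limit_le mw mFk mFf mu mk mf fw fu) => n; rewrite fk.
Qed.

Lemma plancherel_transform_fourier (f : H -> cplx R) :
  @L1L2 R _ (borel H) lam f -> plancherel_transform lam pi f (fourier lam f).
Proof.
move=> Lf; have [f1 f2] := Lf; split => //.
  apply/in_Lp2P; split; first exact: (fl_measurable FL).
  by rewrite -(fl_L2 FL Lf); case: ((in_Lp2P _ _).1 f2).
exists (fun=> f); split => //.
  by rewrite cLnorm2_subrr; exact: cvg_cst.
by rewrite cLnorm2_subrr; exact: cvg_cst.
Qed.

Lemma L1L2_Cc (f : H -> cplx R) : Cc f -> @L1L2 R _ (borel H) lam f.
Proof.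
move=> [cf]; set F := closure _ => cptF.
have mf := continuous_cmeasurable cf.
have mF := compact_Borel K cptF.
have lamF : (lam F < +oo)%E by case: rad => + _ _; exact.
have fF x : f x != 0 -> F x by move=> fx; exact: subset_closure.
have [M M0 fM] : exists2 M : R, 0 <= M & forall x, normc (f x) <= M * \1_F x.
  have out x M : ~ F x -> normc (f x) <= M * \1_F x.
    move=> nFx; rewrite (_ : f x = 0) ?[normc 0]normc0 ?indicE ?memNset ?mulr0//.
    by apply: contrapT => /eqP /fF.
  have [F0|/set0P FN0] := eqVneq F set0.
    by exists 0 => // x; apply: out; rewrite F0.
  have cnf : continuous (fun x => normc (f x)).
    move=> x; apply: (continuous_comp (cf x)); exact: continuous_normc.
  have [c cF cmax] := compact_EVT_max FN0 cptF (continuous_subspaceT cnf).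
  exists (normc (f c)); first exact: normc_ge0.
  move=> x; have [xF|/(out _ (normc (f c)))//] := pselect (F x).
  by rewrite indicE mem_set// mulr1 cmax// mem_set.
have m1F : measurable_fun [set: borel H] (\1_F : borel H -> R).
  exact: measurable_indic.
have bound (c : R) : 0 <= c -> (\int[lam]_x (c * \1_F x)%:E < +oo)%E.
  move=> c0; rewrite ge0_integralZl_real// integral_indic// setIT.
  by rewrite lte_mul_pinfty.
split; [apply/in_Lp1P|apply/in_Lp2P]; split => //.
  apply: le_lt_trans (bound _ M0); apply: ge0_le_integral_EFin => //.
  - exact: cmeasurable_normc.
  - exact: measurable_funM.
  - by move=> x; exact: normc_ge0.
apply: le_lt_trans (bound _ (sqr_ge0 M)); apply: ge0_le_integral_EFin.
- exact/measurable_funX/cmeasurable_normc.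
- exact: measurable_funM.
- by move=> x; exact: sqr_ge0.
move=> x; have -> : M ^+ 2 * \1_F x = (M * \1_F x) ^+ 2 :> R.
  by rewrite exprMn indicE; case: (x \in F); rewrite ?expr1n ?expr0n.
by rewrite lerXn2r ?nnegrE ?normc_ge0// mulr_ge0.
Qed.

End plancherel.

Section symbol.
Context {R : realType}.

Lemma ess_bounded_ae d (Y : measurableType d) (pi : {measure set Y -> \bar R})
  (h : Y -> cplx R) : in_Lp pi +oo%E h ->
  exists B : R, {ae pi, forall y, normc (h y) <= B}.
Proof.
move=> [mh]; rewrite /cLnorm unlock.
case: ifPn => [_|]; last first.
  rewrite -leNgt => piT _; exists 0; exists [set: Y]; split => //.
  by apply/eqP; rewrite eq_le piT measure_ge0.
move=> /ereal_inf_lt[[B| |]//= hB _].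
  exists B; apply: filterS hB => y /=.
  by rewrite lee_fin ger0_norm ?normc_ge0.
exists 0; apply: filterS hB => y /=.
by rewrite leeNy_eq.
Qed.

End symbol.

(** * The multiplier theorem *)

Section multiplier_bound.
Context {R : realType} {H : ptopologicalType} (K : hypergroup R H).
Context (lam : {measure set (borel H) -> \bar R}).
Context (pi : {measure set (borel (dual K)) -> \bar R}).
Implicit Types (h : dual K -> cplx R).

Lemma weak_norm_ge0 (r : R) h : (0 <= weak_norm pi r h)%E.
Proof.
apply: le_ereal_sup_tmp; eexists; first by exists 1 => /=.
by rewrite /=; case: ifP => // _; rewrite mule_ge0// poweR_ge0.
Qed.

Lemma weak_norm_level (r : R) h (M s : R) :
  (weak_norm pi r h <= M%:E)%E -> 0 < s ->
  pi [set chi | (s <= normc (h chi))%R] = 0%E \/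
  (s%:E * pi [set chi | (s <= normc (h chi))%R] `^ r <= M%:E)%E.
Proof.
move=> hM s0; pose level := pi [set chi | (s <= normc (h chi))%R].
have [null|pos] := eqVneq level 0%E; [by left|right].
apply: le_trans hM; apply: ereal_sup_ubound; exists s => //=.
by rewrite -/level (negbTE pos).
Qed.

(** The bound [M] is kept real and positive, since the symbol is divided by it;
the weak norm itself may vanish or be infinite. *)
Lemma opnorm_multiplier_le (p q : R) : 1 < p -> p <= 2 -> 2 <= q ->
  radon lam -> plancherel_measure lam pi ->
  exists2 C : R, 0 < C &
    forall h (T : (H -> cplx R) -> (H -> cplx R)) (M : R),
      in_Lp pi +oo%E h -> fourier_multiplier lam pi h T ->
      0 < M -> (weak_norm pi (p^-1 - q^-1) h <= M%:E)%E ->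
      (opnorm lam p q T <= (C * M)%:E)%E.
Proof.
move=> p1 p2 q2 rad planch.
have FL := fourier_fourier_like rad planch.
have p0 : 0 < p by lra.
have q0 : 0 < q by lra.
have q10 : 0 < q - 1 by lra.
(* the conjugate exponent of [q], for the test functions of the duality *)
pose b := q / (q - 1).
have b1 : 1 < b by rewrite /b ltr_pdivlMr// mul1r; lra.
have b2 : b <= 2 by rewrite /b ler_pdivrMr//; lra.
have rhoE : p^-1 + b^-1 - 1 = p^-1 - q^-1.
  by rewrite /b; field; rewrite !gt_eqF.
have [C C0 form_le] := multiplier_form_le FL p1 p2 b1 b2.
exists C => // h T M hoo mult M0 hM.
have [B0 hB0] := ess_bounded_ae hoo; have [mh _] := hoo.
have CM0 : 0 < C * M by rewrite mulr_gt0.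
apply: ereal_inf_lbound; split; first by rewrite lee_fin ltW.
move=> f Cf; have Lf := L1L2_Cc K rad Cf.
have [mf _] := (in_Lp1P _ _).1 Lf.1.
have [uL2 uT] := mult f Lf.2.
have planchT := uT _ (plancherel_transform_fourier rad planch Lf).
set w := h \* _ in planchT.
have mw : @cmeasurable _ _ (borel (dual K)) w.
  by case: planchT => _ /in_Lp2P[].
have polar k : @L1L2 R _ (borel H) lam k ->
    (\int[lam]_x (normc (T f x + k x)%R ^+ 2)%:E =
     \int[pi]_chi (normc (w chi + fourier lam k chi)%R ^+ 2)%:E)%E /\
    (\int[lam]_x (normc (T f x - k x)%R ^+ 2)%:E =
     \int[pi]_chi (normc (w chi - fourier lam k chi)%R ^+ 2)%:E)%E.
  move=> Lk; split; first exact: plancherel_transform_isometry.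
  rewrite (plancherel_transform_isometry rad planch planchT (L1L2N Lk)).
  by rewrite (flN FL Lk).
pose P := cLnorm lam p%:E f.
have P0 : (0 <= P)%E by exact: Lnorm_ge0.
have [Pfin|] := boolP (P \is a fin_num); last first.
  rewrite ge0_fin_numE// -leNgt leye_eq => /eqP; rewrite -/P => ->.
  by rewrite mulry gtr0_sg// mul1e leey.
(* strictly above the norm of [f], because [f] may vanish and [A] must not *)
have le_of_lt (A : R) : (P < A%:E)%E ->
    (cLnorm lam q%:E (T f) <= (C * M * A)%:E)%E.
  move=> PA; have A0 : 0 < A by rewrite -lte_fin (le_lt_trans P0).
  have fA : (\int[lam]_x (normc (f x) `^ p)%:E <= (A `^ p)%:E)%E.
    have -> : (\int[lam]_x (normc (f x) `^ p)%:E = P `^ p)%E.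
      rewrite /P cLnormE -poweRrM mulVf ?gt_eqF// poweRe1//.
      by apply: integral_ge0_EFin => x; exact: powR_ge0.
    rewrite -poweR_EFin; apply: gt0_ler_poweR; rewrite ?(ltW p0)//; last exact: ltW.
    - by rewrite in_itv /= P0 leey.
    - by rewrite in_itv /= lee_fin (ltW A0) leey.
  have uq : (\int[lam]_x (normc (T f x) `^ q)%:E <= ((C * M * A) `^ q)%:E)%E.
    apply: (Lq_bound FL q2 uL2 mw polar) => k B Lk B00 kB.
    apply: le_trans (form_le h f k M A B B0 mh hB0 M0 _ Lf Lk A0 B00 fA kB).
      rewrite le_eqVlt; apply/orP; left; apply/eqP; apply: eq_integral => chi _.
      by rewrite /w /= normcM.
    by move=> s s0; rewrite rhoE; exact: weak_norm_level.
  have CMA : 0 <= C * M * A by rewrite mulr_ge0// ltW.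
  rewrite cLnormE -(powRr1 CMA) -(mulfV (lt0r_neq0 q0)) powRrM -poweR_EFin.
  apply: gt0_ler_poweR; rewrite ?invr_ge0 ?(ltW q0)//.
  - rewrite in_itv /= leey andbT.
    by apply: integral_ge0_EFin => x; exact: powR_ge0.
  - by rewrite in_itv /= lee_fin powR_ge0 leey.
apply/lee_addgt0Pr => e e0.
have := le_of_lt (fine P + e / (C * M)).
rewrite EFinD fineK// => /(_ _)/le_trans; apply.
  by rewrite lteDl// lte_fin divr_gt0.
by rewrite mulrDr EFinD !EFinM fineK// -!EFinM [X in (_ + X%:E)%E]mulrC divfK ?gt_eqF.
Qed.

End multiplier_bound.

Theorem theorem1p3 (R : realType) (p q : R) (H : ptopologicalType)
    (K : hypergroup R H) (lam : {measure set (borel H) -> \bar R})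
    (pi : {measure set (borel (dual K)) -> \bar R}) :
  1 < p -> p <= 2 -> 2 <= q ->
  commutative_hypergroup K -> haar_measure K lam -> plancherel_measure lam pi ->
  exists2 C : R, 0 < C &
    forall (h : dual K -> cplx R) (T : (H -> cplx R) -> (H -> cplx R)),
      in_Lp pi +oo%E h -> fourier_multiplier lam pi h T ->
      (opnorm lam p q T <= C%:E * weak_norm pi (p^-1 - q^-1) h)%E.
Proof.
move=> p1 p2 q2 _ [rad _ _] planch.
have [C C0 bound] := opnorm_multiplier_le p1 p2 q2 rad planch.
exists C => // h T hoo mult.
have := weak_norm_ge0 pi (p^-1 - q^-1) h.
have le_bound (M : R) : 0 < M -> (weak_norm pi (p^-1 - q^-1) h <= M%:E)%E ->
    (opnorm lam p q T <= (C * M)%:E)%E by move=> M0; exact: bound.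
move: le_bound; case: (weak_norm _ _ _) => [m| |]// le_bound m0.
  apply/lee_addgt0Pr => e e0.
  have eC : 0 < e / C by rewrite divr_gt0.
  apply: le_trans (le_bound (m + e / C) _ _) _.
  - by rewrite ltr_wpDl.
  - by rewrite lee_fin lerDl ltW.
  by rewrite -EFinM -EFinD lee_fin mulrDr [X in _ + X]mulrC divfK ?gt_eqF.
by rewrite mulry gtr0_sg// mul1e leey.
Qed.
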